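(* Let $\eta\in(0,1)$. Up to multiplicative constants depending only on $\eta$ (uniformly over $d\ge1$, $\sigma_1\ge\dots\ge\sigma_d>0$ and $s\in\{1,\dots,d\}$), $$\epsilon^*(s,2,\Sigma)^2\ \asymp\ \lambda_2 s+\nu_2\ \asymp\ \lambda_2 s+\Big(\sum_{j\le j_*}\sigma_j^4\Big)^{1/2},$$ where $\nu_2=\big(\sum_{j=1}^d\sigma_j^4\exp(-\lambda_2/\sigma_j^2)\big)^{1/2}$ and $j_*=\max\{j\in[d]:\sigma_j^2\ge\lambda_2\}$.
   Context: Testing problem. Let $d\ge1$, $[d]=\{1,\dots,d\}$, $\sigma_1\ge\dots\ge\sigma_d>0$ known, $\Sigma=\operatorname{diag}(\sigma_1^2,\dots,\sigma_d^2)$. For $\theta\in\mathbb R^d$, $\mathbb P_\theta$ denotes the law of $X\sim\mathcal N(\theta,\Sigma)$. $\|u\|_0=\operatorname{Card}\{j:u_j\ne0\}$. For $\epsilon>0$, $s\in[d]$: $\Theta(\epsilon,s,2)=\{\theta\in\mathbb R^d:\|\theta\|_2\ge\epsilon,\ \|\theta\|_0\le s\}$. A test is a measurable $\psi:\mathbb R^d\to\{0,1\}$ of $X$; its risk is $R(\psi,\epsilon,s,2,\Sigma)=\mathbb P_0(\psi=1)+\sup_{\theta\in\Theta(\epsilon,s,2)}\mathbb P_\theta(\psi=0)$; $R^*=\inf_\psi R$ over all tests; $\epsilon^*(s,2,\Sigma)=\inf\{\epsilon>0:R^*(\epsilon,s,2,\Sigma)\le\eta\}$. Parameters. Let $\beta\in\mathbb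 R$ be the unique solution of $$\frac{\sum_{j=1}^d\sigma_j^2e^{-\beta/\sigma_j^2}}{\sqrt{\sum_{j=1}^d\sigma_j^4e^{-\beta/\sigma_j^2}}}=\frac s2,\qquad \lambda_2=\max(\beta,0).$$ The maximum of an empty set of indices is $0$, and empty sums are $0$. $f\asymp g$ means $c\,g\le f\le C\,g$ for constants $c,C>0$ depending only on $\eta$. *)

(* Defs.v *)
From HB Require Import structures.
From mathcomp Require Import all_boot all_order all_algebra.
From mathcomp Require Import all_classical all_reals all_analysis.

Set Implicit Arguments.
Unset Strict Implicit.
Unset Printing Implicit Defensive.

Import Order.TTheory GRing.Theory Num.Theory.
Import numFieldNormedType.Exports.

Local Open Scope classical_set_scope.
Local Open Scope ring_scope.

(* R^d is [d.-tuple R], with the product of the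
   Borel sigma-algebras; coordinates are numbered from 0. *)

Definition cons_pair (R : realType) (d : nat)
    (p : measurableTypeR R * d.-tuple (measurableTypeR R)) :
    d.+1.-tuple (measurableTypeR R) :=
  [tuple of p.1 :: p.2].

Lemma measurable_cons_pair (R : realType) (d : nat) :
  measurable_fun setT (@cons_pair R d).
Proof. exact: measurable_cons. Qed.

HB.instance Definition _ (R : realType) (d : nat) :=
  isMeasurableFun.Build _ _ _ _ (@cons_pair R d) (@measurable_cons_pair R d).

(* The law N(theta, diag(sigma_0^2, .., sigma_(d-1)^2)) on R^d, as the d-fold
   product of the one-dimensional laws N(theta_j, sigma_j^2); the second
   parameter of [normal_prob] is a standard deviation. *)
Fixpoint gaussian (R : realType) (d : nat) :
    d.-tuple R -> ('I_d -> R) -> probability (d.-tuple (measurableTypeR R)) R :=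
  match d with
  | 0 => fun _ _ => dirac [tuple]
  | d'.+1 => fun theta sigma =>
      distribution
        (normal_prob (thead theta) (sigma ord0) \x
         gaussian [tuple of behead theta] (fun j => sigma (lift ord0 j)))%E
        (@cons_pair R d')
  end.

Lemma gaussian_rectangle (R : realType) (d : nat) (theta : d.-tuple R)
    (sigma : 'I_d -> R) (A : 'I_d -> set (measurableTypeR R)) :
  (forall j, measurable (A j)) ->
  gaussian theta sigma [set x | forall j, A j (tnth x j)] =
  (\prod_(j < d) normal_prob (tnth theta j) (sigma j) (A j))%E.
Proof.
elim: d => [|d IH] in theta sigma A * => mA.
  rewrite big_ord0 /= diracE mem_set//=.
  by case.
have mrect : measurable [set x : d.-tuple (measurableTypeR R) |
    forall j, A (lift ord0 j) (tnth x j)].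
  rewrite (_ : [set _ | _] =
      \bigcap_(j in [set: 'I_d]) ((@tnth d (measurableTypeR R))^~ j @^-1`
                                    A (lift ord0 j))); last first.
    by apply/seteqP; split => x /= Ax j; [move=> _; exact: Ax|exact: (Ax j)].
  apply: fin_bigcap_measurable => // j _.
  rewrite -[X in measurable X]setTI.
  exact: measurable_tnth.
rewrite big_ord_recl /= /distribution /pushforward.
rewrite (_ : _ @^-1` _ = A ord0 `*` [set x : d.-tuple (measurableTypeR R) |
    forall j, A (lift ord0 j) (tnth x j)]); last first.
  apply/seteqP; split => -[x y] /=.
    move=> Axy; split; first exact: (Axy ord0).
    by move=> j; move: (Axy (lift ord0 j)); rewrite /cons_pair tnthS.
  move=> [Ax Ay] j; have [->|j0] := eqVneq j ord0; first exact: Ax.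
  have [k ->] : exists k, j = lift ord0 k.
    by case: (unliftP ord0 j) j0 => [k -> _|->]; [exists k|rewrite eqxx].
  by rewrite /cons_pair tnthS; exact: Ay.
rewrite product_measure1E//; congr (_ * _)%E.
transitivity (\prod_(j < d) normal_prob (tnth [tuple of behead theta] j)
    (sigma (lift ord0 j)) (A (lift ord0 j)))%E.
  exact: (IH [tuple of behead theta] (fun j => sigma (lift ord0 j))
            (fun j => A (lift ord0 j))).
apply: eq_bigr => j _.
by rewrite [in RHS](tuple_eta theta) tnthS.
Qed.

Section testing_problem.
Variables (R : realType) (d : nat).
Implicit Types (theta : d.-tuple R) (sigma : 'I_d -> R) (s : nat).

Definition norm2 theta : R := Num.sqrt (\sum_(j < d) tnth theta j ^+ 2).

Definition norm0 theta : nat := #|[pred j | tnth theta j != 0]|.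

Definition alternative (eps : R) s : set (d.-tuple R) :=
  [set theta | eps <= norm2 theta /\ (norm0 theta <= s)%N].

Definition test := {mfun d.-tuple (measurableTypeR R) >-> bool}.

Local Open Scope ereal_scope.

Definition risk (psi : test) (eps : R) s sigma : \bar R :=
  gaussian [tuple 0%R | _ < d] sigma [set x | psi x = true] +
  ereal_sup [set gaussian theta sigma [set x | psi x = false]
            | theta in alternative eps s].

Definition minimax_risk (eps : R) s sigma : \bar R :=
  ereal_inf [set risk psi eps s sigma | psi in [set: test]].

Definition separation_radius (eta : R) s sigma : \bar R :=
  ereal_inf [set eps%:E | eps in
    [set eps : R | (0 < eps)%R /\ minimax_risk eps s sigma <= eta%:E]].

Local Close Scope ereal_scope.

Definition beta_equation s sigma (b : R) : Prop :=
  (\sum_(j < d) sigma j ^+ 2 * expR (- b / sigma j ^+ 2)) /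
  Num.sqrt (\sum_(j < d) sigma j ^+ 4 * expR (- b / sigma j ^+ 2)) =
  s%:R / 2%:R.

(* When d, s > 0 and all sigma_j > 0, the left-hand side of the equation is
   continuous and decreasing in b, from +oo at -oo to 0 at +oo, so that there
   is exactly one solution; [get] selects it. *)
Definition beta s sigma : R := get (beta_equation s sigma).

Definition lambda2 s sigma : R := Num.max (beta s sigma) 0.

Definition nu2 s sigma : R :=
  Num.sqrt (\sum_(j < d) sigma j ^+ 4 * expR (- lambda2 s sigma / sigma j ^+ 2)).

(* The index j of the coordinate numbered from 0 has rank j.+1 in {1, .., d};
   the value is 0 if no coordinate qualifies. *)
Definition jstar s sigma : nat :=
  \max_(j < d | lambda2 s sigma <= sigma j ^+ 2) j.+1.

Definition head_norm s sigma : R :=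
  Num.sqrt (\sum_(j < d | (j.+1 <= jstar s sigma)%N) sigma j ^+ 4).

End testing_problem.

(* Main.v *)
From HB Require Import structures.
Require Import Defs.
From mathcomp Require Import all_boot all_order all_algebra.
From mathcomp Require Import all_classical all_reals all_analysis measurable_realfun.
From mathcomp Require Import ring lra.

(* Write [a_j = sigma_j ^ 2], [l = lambda2], [nu = nu2].

   Upper bound: reject when the sum over [j] of [max (X_j ^ 2 - 4 l, 0)],
   centred under the null, exceeds a large multiple of [nu].  Since
   [max (y, 0) ^ 2 <= 32 a ^ 2 exp (y / (4 a))], each term has null variance at
   most [64 a_j ^ 2 exp (- l / a_j)], so the statistic has null standard
   deviation of order [nu].  Truncation costs at most [4 l] per coordinate of
   the support of [theta]: there the term is at least [X_j ^ 2 - E_0 X_j ^ 2 - 4 l],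
   so under [theta] the statistic is at least [|theta| ^ 2 - 4 l s] up to
   fluctuations that Chebyshev's inequality controls.

   Lower bound: take a random support with independent inclusion probabilities
   [p_j = a_j exp (- l / a_j) / nu], whose sum is at most [s / 2] by the equation
   defining [beta], and [theta_j ^ 2 = kap (l + a_j)] on it.  A second moment
   argument shows that with probability at least 1/80 this point is [s]-sparse
   with squared norm of order [kap (l s + nu)].  Conditioning on that event
   multiplies the chi-square divergence to the null by at most [80 ^ 2], because
   all terms [exp (<theta, theta'>) - 1] are nonnegative, and the unconditional
   divergence is at most [prod (1 + p_j ^ 2 (exp (kap (1 + l / a_j)) - 1)) - 1],
   which is of order [kap]. *)

Set Implicit Arguments.
Unset Strict Implicit.
Unset Printing Implicit Defensive.

Import Order.TTheory GRing.Theory Num.Theory.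
Import numFieldNormedType.Exports.
Local Open Scope classical_set_scope.
Local Open Scope ring_scope.

(** * One-dimensional normal laws *)

Section normal_law.
Context {R : realType}.
Local Notation mu := (@lebesgue_measure R).
Implicit Types (f : measurableTypeR R -> \bar R) (m s x : R).

(** Lebesgue measure is determined by half-open intervals, and the preimage of such an interval is
    one of the same length. *)
Lemma lebesgue_measure_shift m (A : set R) : measurable A ->
  pushforward mu (fun x : measurableTypeR R => x + m : measurableTypeR R) A =
  mu A.
Proof.
move=> mA; apply/esym/lebesgue_measure_unique => //=.
  exact: measurable_funD.
move=> ms _ [[a b]] _ <-.
rewrite /pushforward.
rewrite (_ : _ @^-1` _ = `](a - m), (b - m)]%classic); last first.
  by apply/seteqP; split => x /=; rewrite !in_itv/= ltrBlDr lerBrDr.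
rewrite !lebesgue_measure_itv/= !lte_fin ltrD2r.
by case: ifPn => // _; rewrite -!EFinD; congr (_%:E); ring.
Qed.

Lemma ge0_integral_shift m f : measurable_fun setT f -> (forall x, 0 <= f x)%E ->
  (\int[mu]_x f x = \int[mu]_x f (x + m)%R)%E.
Proof.
move=> mf f0.
have ms : measurable_fun setT
    (fun x : measurableTypeR R => x + m : measurableTypeR R).
  exact: measurable_funD.
transitivity (\int[pushforward mu
    (fun x : measurableTypeR R => (x + m)%R : measurableTypeR R)]_x f x)%E.
  by apply: eq_measure_integral => A mA _; exact/esym/lebesgue_measure_shift.
by rewrite (ge0_integral_pushforward ms).
Qed.

Lemma ge0_integral_opp f : measurable_fun setT f -> (forall x, 0 <= f x)%E ->
  (\int[mu]_x f x = \int[mu]_x f (- x)%R)%E.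
Proof.
move=> mf f0.
transitivity (\int[pushforward mu
    (-%R : measurableTypeR R -> measurableTypeR R)]_x f x)%E.
  by apply: eq_measure_integral => A mA _; exact/esym/lebesgue_measureN.
by rewrite ge0_integral_pushforward.
Qed.

(** [normal_pdf] and the Radon-Nikodym derivative have the same integral over every measurable set,
    hence agree almost everywhere. *)
Lemma ge0_integral_normal m s f :
  measurable_fun setT f -> (forall x, 0 <= f x)%E ->
  (\int[normal_prob m s]_x f x = \int[mu]_x (f x * (normal_pdf m s x)%:E))%E.
Proof.
move=> mf f0.
rewrite -(@Radon_Nikodym_SigmaFinite.change_of_variables _ _ _
  (normal_prob m s) mu (normal_prob_dominates m s))//.
have mpdf : measurable_fun setT (fun x => (normal_pdf m s x)%:E).
  by apply/measurable_EFinP; exact: measurable_normal_pdf.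
have mRN := measurable_int _
  (Radon_Nikodym_SigmaFinite.f_integrable (normal_prob_dominates m s)).
apply: ae_eq_integral => //; [exact: emeasurable_funM|exact: emeasurable_funM|].
apply: ae_eqe_mul2l; apply: integral_ae_eq => //.
  exact: (Radon_Nikodym_SigmaFinite.f_integrable (normal_prob_dominates m s)).
by move=> E _ mE; rewrite -Radon_Nikodym_SigmaFinite.f_integral//;
  exact: normal_prob_dominates.
Qed.

Lemma ge0_integral_normal_shift m s f : 0 < s ->
  measurable_fun setT f -> (forall x, 0 <= f x)%E ->
  (\int[normal_prob m s]_x f x = \int[normal_prob 0%R s]_x f (x + m)%R)%E.
Proof.
move=> s0 mf f0.
have ms : measurable_fun setT
    (fun x : measurableTypeR R => x + m : measurableTypeR R).
  exact: measurable_funD.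
have pdf0 (m' : R) x : (0 <= (normal_pdf m' s x)%:E)%E.
  by rewrite lee_fin normal_pdf_ge0.
have mpdf (m' : R) : measurable_fun setT (fun x => (normal_pdf m' s x)%:E).
  by apply/measurable_EFinP; exact: measurable_normal_pdf.
rewrite (ge0_integral_normal m s mf f0).
rewrite (ge0_integral_normal 0 s (f := fun x => f (x + m)%R)); last 2 first.
- exact: measurableT_comp mf ms.
- by move=> x.
rewrite (ge0_integral_shift m).
- apply: eq_integral => x _; rewrite !normal_pdfE ?gt_eqF// /normal_fun.
  by rewrite addrK subr0.
- by apply: emeasurable_funM; [exact: mf|exact: mpdf].
- by move=> x; apply: mule_ge0; [exact: f0|exact: pdf0].
Qed.

Lemma ge0_integral_normal_opp s f : 0 < s ->
  measurable_fun setT f -> (forall x, 0 <= f x)%E ->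
  (\int[normal_prob 0%R s]_x f x = \int[normal_prob 0%R s]_x f (- x)%R)%E.
Proof.
move=> s0 mf f0.
have pdf0 (m' : R) x : (0 <= (normal_pdf m' s x)%:E)%E.
  by rewrite lee_fin normal_pdf_ge0.
have mpdf (m' : R) : measurable_fun setT (fun x => (normal_pdf m' s x)%:E).
  by apply/measurable_EFinP; exact: measurable_normal_pdf.
rewrite (ge0_integral_normal 0 s mf f0).
rewrite (ge0_integral_normal 0 s (f := fun x => f (- x)%R)); last 2 first.
- by apply: (measurableT_comp mf); exact: oppr_measurable.
- by move=> x.
rewrite ge0_integral_opp.
- apply: eq_integral => x _; rewrite !normal_pdfE ?gt_eqF// /normal_fun.
  by rewrite !subr0 sqrrN.
- by apply: emeasurable_funM; [exact: mf|exact: mpdf].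
- by move=> x; apply: mule_ge0; [exact: f0|exact: pdf0].
Qed.

(** The density of N(m, s^2) with respect to N(0, s^2). *)
Definition likelihood m s x : R := expR ((m * x - m ^+ 2 / 2) / s ^+ 2).

Lemma likelihood_ge0 m s x : 0 <= likelihood m s x.
Proof. exact: expR_ge0. Qed.

Lemma measurable_likelihood m s : measurable_fun setT (likelihood m s).
Proof.
apply: measurableT_comp => //; apply: measurable_funM => //.
by apply: measurable_funB => //; exact: measurable_funM.
Qed.

Lemma ge0_integral_normal_likelihood m s f : 0 < s ->
  measurable_fun setT f -> (forall x, 0 <= f x)%E ->
  (\int[normal_prob m s]_x f x =
   \int[normal_prob 0%R s]_x (f x * (likelihood m s x)%:E))%E.
Proof.
move=> s0 mf f0.
have mlik : measurable_fun setT (fun x => (likelihood m s x)%:E).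
  by apply/measurable_EFinP; exact: measurable_likelihood.
rewrite (ge0_integral_normal m s mf f0).
rewrite (ge0_integral_normal 0 s (f := fun x => (f x * (likelihood m s x)%:E)%E)).
- apply: eq_integral => x _; rewrite -muleA -EFinM; congr (_ * _%:E)%E.
  rewrite !normal_pdfE ?gt_eqF// mulrCA; congr (_ * _).
  rewrite /normal_fun /likelihood -expRD; congr expR.
  by field; rewrite gt_eqF.
- by apply: emeasurable_funM; [exact: mf|exact: mlik].
- by move=> x; rewrite mule_ge0// lee_fin likelihood_ge0.
Qed.

(** The product of the two likelihoods is [expR (m * m' / s ^+ 2)] times the likelihood of mean
    [m + m'], which integrates to 1. *)
Lemma integral_likelihoodM m m' s : 0 < s ->
  (\int[normal_prob 0%R s]_x (likelihood m s x * likelihood m' s x)%:E =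
   (expR (m * m' / s ^+ 2))%:E)%E.
Proof.
move=> s0.
transitivity (\int[normal_prob 0%R s]_x
    ((expR (m * m' / s ^+ 2))%:E * (likelihood (m + m')%R s x)%:E))%E.
  apply: eq_integral => x _; rewrite -EFinM; congr (_%:E).
  by rewrite /likelihood -!expRD; congr expR; field; rewrite gt_eqF.
rewrite -(@ge0_integral_normal_likelihood _ s
  (cst (expR (m * m' / s ^+ 2))%:E))//.
- by rewrite integral_cst//= probability_setT mule1.
- by move=> x; rewrite lee_fin expR_ge0.
Qed.

(** Multiplied by this exponential, the density becomes [Num.sqrt 2] times that of standard
    deviation [Num.sqrt 2 * s], so the integral is [Num.sqrt 2]. *)
Lemma integral_normal_expR_sqr s : 0 < s ->
  (\int[normal_prob 0%R s]_x (expR (x ^+ 2 / (4 * s ^+ 2)))%:E <= 2%:E)%E.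
Proof.
move=> s0.
have s20 : 0 < Num.sqrt 2 * s by rewrite mulr_gt0// sqrtr_gt0.
have mpdf : measurable_fun setT (fun x => (normal_pdf 0 (Num.sqrt 2 * s) x)%:E).
  by apply/measurable_EFinP; exact: measurable_normal_pdf.
have peak2 : normal_peak s = Num.sqrt 2 * normal_peak (Num.sqrt 2 * s).
  have p0 : 0 < s ^+ 2 * pi *+ 2 by rewrite mulrn_wgt0// mulr_gt0 ?exprn_gt0 ?pi_gt0.
  rewrite /normal_peak exprMn sqr_sqrtr//.
  have -> : 2 * s ^+ 2 * pi *+ 2 = 2 * (s ^+ 2 * pi *+ 2) by ring.
  by rewrite [in RHS]sqrtrM// invfM mulVKf// gt_eqF// sqrtr_gt0.
rewrite ge0_integral_normal//; last first.
  apply/measurable_EFinP; apply: measurableT_comp => //.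
  by apply: measurable_funM => //; exact: measurable_funX.
rewrite [leLHS](_ : _ = \int[mu]_x
   ((Num.sqrt 2)%:E * (normal_pdf 0 (Num.sqrt 2 * s)%R x)%:E))%E; last first.
  apply: eq_integral => x _; rewrite -!EFinM; congr (_%:E).
  have pdfE t : 0 < t -> normal_pdf 0 t x = normal_peak t * normal_fun 0 t x.
    by move=> t0; rewrite normal_pdfE ?gt_eqF.
  rewrite !pdfE// peak2 mulrCA -!mulrA; congr (_ * (_ * _)).
  rewrite /normal_fun -expRD; congr expR.
  by rewrite exprMn sqr_sqrtr//; field; rewrite gt_eqF.
rewrite ge0_integralZl//; last by move=> x _; rewrite lee_fin normal_pdf_ge0.
rewrite integral_normal_pdf mule1 lee_fin.
by rewrite -[leRHS](ger0_norm (ler0n _ 2)) -sqrtr_sqr ler_sqrt//; lra.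
Qed.

End normal_law.

(** * Product normal laws *)

Section gaussian_law.
Context {R : realType}.
Local Notation T := (measurableTypeR R).

(** Tonelli peels off the first coordinate; the inductions on [d] below rest on this. *)
Lemma ge0_integral_gaussianS d (theta : d.+1.-tuple R) (sigma : 'I_d.+1 -> R)
    (F : d.+1.-tuple T -> \bar R) :
  measurable_fun setT F -> (forall x, 0 <= F x)%E ->
  (\int[gaussian theta sigma]_x F x =
   \int[normal_prob (thead theta) (sigma ord0)]_x
     \int[gaussian [tuple of behead theta] (fun j => sigma (lift ord0 j))]_y
       F (cons_pair (x, y)))%E.
Proof.
move=> mF F0 /=.
rewrite (ge0_integral_pushforward (@measurable_cons_pair R d))//.
rewrite fubini_tonelli1//; last by move=> z; exact: F0.
exact: measurableT_comp mF (@measurable_cons_pair R d).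
Qed.

Lemma measurable_cons_pair2 d (x : T) :
  measurable_fun setT (fun y : d.-tuple T => cons_pair (x, y)).
Proof.
exact: (measurableT_comp (@measurable_cons_pair R d) (measurable_pair1 x)).
Qed.

Lemma measurable_prod_tnth d (f : 'I_d -> T -> R) :
  (forall j, measurable_fun setT (f j)) ->
  measurable_fun setT (fun x : d.-tuple T => \prod_(j < d) f j (tnth x j)).
Proof.
move=> mf; apply: measurable_prod => j _.
exact: measurableT_comp (mf j) (measurable_tnth j).
Qed.

Lemma measurable_sum_tnth d (f : 'I_d -> T -> R) :
  (forall j, measurable_fun setT (f j)) ->
  measurable_fun setT (fun x : d.-tuple T => \sum_(j < d) f j (tnth x j)).
Proof.
move=> mf; apply: measurable_sum => j.
exact: measurableT_comp (mf j) (measurable_tnth j).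
Qed.

Lemma tnth_cons_pairS d (x : T) (y : d.-tuple T) j :
  tnth (cons_pair (x, y)) (lift ord0 j) = tnth y j.
Proof. by rewrite /cons_pair tnthS. Qed.

Lemma tnth_behead_tuple d (theta : d.+1.-tuple R) j :
  tnth [tuple of behead theta] j = tnth theta (lift ord0 j).
Proof. by rewrite [in RHS](tuple_eta theta) tnthS. Qed.

Lemma integral_gaussian_prod d (theta : d.-tuple R) (sigma : 'I_d -> R)
    (f : 'I_d -> T -> R) (e : 'I_d -> R) :
  (forall j, measurable_fun setT (f j)) -> (forall j x, 0 <= f j x) ->
  (forall j, \int[normal_prob (tnth theta j) (sigma j)]_x (f j x)%:E = (e j)%:E)%E ->
  (\int[gaussian theta sigma]_x (\prod_(j < d) f j (tnth x j))%:E =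
   (\prod_(j < d) e j)%:E)%E.
Proof.
elim: d => [|d IH] in theta sigma f e * => mf f0 fe.
  under eq_integral do rewrite big_ord0.
  by rewrite big_ord0 integral_cst//= mul1e diracT.
rewrite ge0_integral_gaussianS; last 2 first.
- by apply/measurable_EFinP; exact: measurable_prod_tnth.
- by move=> x; rewrite lee_fin prodr_ge0.
have IH' := IH [tuple of behead theta] (fun j => sigma (lift ord0 j))
  (fun j => f (lift ord0 j)) (fun j => e (lift ord0 j))
  (fun j => mf _) (fun j => f0 _) _.
rewrite big_ord_recl EFinM -fe.
rewrite -ge0_integralZr//; last 3 first.
- exact/measurable_EFinP.
- by move=> x _; rewrite lee_fin.
- rewrite lee_fin prodr_ge0// => j _; rewrite -lee_fin -fe.
  by apply: integral_ge0 => x _; rewrite lee_fin.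
apply: eq_integral => x _; rewrite -IH'; last first.
  by move=> j; rewrite tnth_behead_tuple fe.
rewrite -ge0_integralZl//; last 3 first.
- apply/measurable_EFinP.
  exact: (measurable_prod_tnth (f := fun j => f (lift ord0 j))).
- by move=> y _; rewrite lee_fin prodr_ge0.
- by rewrite lee_fin.
apply: eq_integral => y _; rewrite -EFinM big_ord_recl; congr (_ * _)%:E.
by apply: eq_bigr => j _; rewrite tnth_cons_pairS.
Qed.

(** Asking the bound for every [c] says that [f j] is centred with variance at most [v j]. In this
    form the induction goes through: the remaining sum is integrated with offset [c + f ord0 x]. *)
Lemma integral_gaussian_sqr_sum_le d (theta : d.-tuple R) (sigma : 'I_d -> R)
    (f : 'I_d -> T -> R) (v : 'I_d -> R) :
  (forall j, measurable_fun setT (f j)) ->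
  (forall j c, \int[normal_prob (tnth theta j) (sigma j)]_x
     ((c + f j x) ^+ 2)%:E <= (c ^+ 2 + v j)%:E)%E ->
  forall c, (\int[gaussian theta sigma]_x
     ((c + \sum_(j < d) f j (tnth x j)) ^+ 2)%:E <=
   (c ^+ 2 + \sum_(j < d) v j)%:E)%E.
Proof.
elim: d => [|d IH] in theta sigma f v * => mf fv c.
  under eq_integral do rewrite big_ord0.
  by rewrite big_ord0 integral_cst//= diracT mule1 !addr0.
have mF c' : measurable_fun setT (fun x : d.+1.-tuple T =>
    ((c' + \sum_(j < d.+1) f j (tnth x j)) ^+ 2)%:E).
  apply/measurable_EFinP; apply: measurable_funX; apply: measurable_funD => //.
  exact: measurable_sum_tnth.
rewrite ge0_integral_gaussianS//; last by move=> x; rewrite lee_fin sqr_ge0.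
have IH' := IH [tuple of behead theta] (fun j => sigma (lift ord0 j))
  (fun j => f (lift ord0 j)) (fun j => v (lift ord0 j)) (fun j => mf _) _.
set s := \sum_(j < d) v (lift ord0 j).
have s0 : 0 <= s.
  apply: sumr_ge0 => j _; have := fv (lift ord0 j) 0.
  rewrite expr0n/= add0r => /(le_trans _); rewrite -lee_fin; apply.
  by apply: integral_ge0 => x _; rewrite lee_fin sqr_ge0.
have mf0 : measurable_fun setT (fun x => ((c + f ord0 x) ^+ 2)%:E).
  by apply/measurable_EFinP; apply: measurable_funX; apply: measurable_funD.
apply: (@le_trans _ _ (\int[normal_prob (thead theta) (sigma ord0)]_x
    (((c + f ord0 x) ^+ 2)%:E + s%:E))%E); last first.
  rewrite ge0_integralD//; [|by move=> x _; rewrite lee_fin sqr_ge0].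
  rewrite integral_cst//= [X in (_ * X)%E]probability_setT mule1.
  rewrite big_ord_recl addrA EFinD leeD2r//.
  by have := fv ord0 c; rewrite -[tnth theta ord0]/(thead theta).
apply: ge0_le_integral => //.
- by move=> x _; apply: integral_ge0 => y _; rewrite lee_fin sqr_ge0.
- apply: (measurable_fun_fubini_tonelli_F
    (fun z : T * d.-tuple T => ((c + \sum_(j < d.+1) f j (tnth (cons_pair z) j)) ^+ 2)%:E)).
    exact: measurableT_comp (mF c) (@measurable_cons_pair R d).
  by move=> x; rewrite lee_fin sqr_ge0.
- exact: emeasurable_funD.
- move=> x _; rewrite -EFinD; apply: le_trans (IH' _ (c + f ord0 x)); last first.
    by move=> j c'; rewrite tnth_behead_tuple fv.
  rewrite le_eqVlt; apply/orP; left; apply/eqP; apply: eq_integral => y _.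
  rewrite big_ord_recl addrA; congr (((_ + _) ^+ 2)%:E).
  by apply: eq_bigr => j _; rewrite tnth_cons_pairS.
Qed.

Lemma behead_zero_tuple d :
  [tuple of behead [tuple (0 : R) | _ < d.+1]] = [tuple 0 | _ < d].
Proof. by apply: eq_from_tnth => j; rewrite tnth_behead_tuple !tnth_mktuple. Qed.

Definition gaussian_likelihood d (theta : d.-tuple R) (sigma : 'I_d -> R)
    (x : d.-tuple T) : R :=
  \prod_(j < d) likelihood (tnth theta j) (sigma j) (tnth x j).

Lemma gaussian_likelihood_ge0 d (theta : d.-tuple R) (sigma : 'I_d -> R) x :
  0 <= gaussian_likelihood theta sigma x.
Proof. by apply: prodr_ge0 => j _; exact: likelihood_ge0. Qed.

Lemma measurable_gaussian_likelihood d (theta : d.-tuple R) (sigma : 'I_d -> R) :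
  measurable_fun setT (gaussian_likelihood theta sigma).
Proof.
apply: (measurable_prod_tnth (f := fun j => likelihood (tnth theta j) (sigma j))).
by move=> j; exact: measurable_likelihood.
Qed.

Lemma ge0_integral_gaussian_likelihood d (theta : d.-tuple R)
    (sigma : 'I_d -> R) (F : d.-tuple T -> \bar R) :
  (forall j, 0 < sigma j) -> measurable_fun setT F -> (forall x, 0 <= F x)%E ->
  (\int[gaussian theta sigma]_x F x =
   \int[gaussian [tuple 0%R | _ < d] sigma]_x
     (F x * (gaussian_likelihood theta sigma x)%:E))%E.
Proof.
elim: d => [|d IH] in theta sigma F * => s0 mF F0.
  apply: eq_integral => x _.
  by rewrite /gaussian_likelihood big_ord0 mule1.
have mL : measurable_fun setT (fun x => (gaussian_likelihood theta sigma x)%:E).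
  by apply/measurable_EFinP; exact: measurable_gaussian_likelihood.
have mFc x : measurable_fun setT (fun y : d.-tuple T => F (cons_pair (x, y))).
  exact: measurableT_comp mF (measurable_cons_pair2 x).
rewrite [LHS](ge0_integral_gaussianS theta sigma mF F0).
rewrite [RHS](@ge0_integral_gaussianS d [tuple 0 | _ < d.+1] sigma
  (fun x => F x * (gaussian_likelihood theta sigma x)%:E)%E); last 2 first.
- exact: emeasurable_funM.
- by move=> x; rewrite mule_ge0// lee_fin gaussian_likelihood_ge0.
rewrite behead_zero_tuple /thead tnth_mktuple.
rewrite (@ge0_integral_normal_likelihood _ _ _ (fun x : T =>
  \int[gaussian _ _]_y F (cons_pair (x, y)))%E); last 3 first.
- exact: s0.
- apply: (measurable_fun_fubini_tonelli_F (fun z : T * d.-tuple T => F (cons_pair z))) => //.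
  exact: measurableT_comp mF (@measurable_cons_pair R d).
- by move=> x; exact: integral_ge0.
apply: eq_integral => x _.
rewrite (IH _ _ _ (fun j => s0 _) (mFc x) (fun y => F0 _)).
rewrite -ge0_integralZr; last 4 first.
- exact: measurableT.
- apply: emeasurable_funM => //.
  by apply/measurable_EFinP; exact: measurable_gaussian_likelihood.
- by move=> y _; rewrite mule_ge0// lee_fin gaussian_likelihood_ge0.
- by rewrite lee_fin likelihood_ge0.
apply: eq_integral => y _; rewrite -muleA -EFinM; congr (_ * _%:E)%E.
rewrite mulrC /gaussian_likelihood big_ord_recl; congr (_ * _).
by apply: eq_bigr => j _; rewrite tnth_cons_pairS tnth_behead_tuple.
Qed.

Lemma gaussian_prob_likelihood d (theta : d.-tuple R) (sigma : 'I_d -> R)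
    (A : set (d.-tuple T)) :
  (forall j, 0 < sigma j) -> measurable A ->
  (gaussian theta sigma A =
   \int[gaussian [tuple 0%R | _ < d] sigma]_(x in A)
     (gaussian_likelihood theta sigma x)%:E)%E.
Proof.
move=> s0 mA; transitivity (\int[gaussian theta sigma]_x (\1_A x)%:E)%E.
  by rewrite integral_indic// setIT.
rewrite [LHS]ge0_integral_gaussian_likelihood; last 3 first.
- exact: s0.
- by apply/measurable_EFinP; exact: measurable_indic.
- by move=> x; rewrite lee_fin.
rewrite [RHS]integral_mkcond; apply: eq_integral => x _.
by rewrite epatch_indic muleC.
Qed.

(** The coordinates are independent, so the one-dimensional values multiply. These are the entries
    of the second moment of a mixture likelihood. *)
Lemma integral_gaussian_likelihoodM d (theta theta' : d.-tuple R)
    (sigma : 'I_d -> R) : (forall j, 0 < sigma j) ->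
  (\int[gaussian [tuple 0%R | _ < d] sigma]_x
     (gaussian_likelihood theta sigma x * gaussian_likelihood theta' sigma x)%:E =
   (\prod_(j < d) expR (tnth theta j * tnth theta' j / sigma j ^+ 2))%:E)%E.
Proof.
move=> s0.
rewrite -(@integral_gaussian_prod _ [tuple 0 | _ < d] sigma
   (fun j x => likelihood (tnth theta j) (sigma j) x * likelihood (tnth theta' j) (sigma j) x)).
- by apply: eq_integral => x _; rewrite big_split.
- by move=> j; apply: measurable_funM; exact: measurable_likelihood.
- by move=> j x; rewrite mulr_ge0// likelihood_ge0.
- by move=> j; rewrite tnth_mktuple integral_likelihoodM.
Qed.

End gaussian_law.

(** * Second moments *)

Section second_moment.
Context {R : realType} d (T : measurableType d) (P : probability T R).

(** The cross term vanishes after centring, and the variance is at most the raw second moment. The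
    free [c] matches the hypothesis of [integral_gaussian_sqr_sum_le]. *)
Lemma integral_sqr_center_le (Y : T -> R) (v : R) :
  measurable_fun setT Y -> (forall x, 0 <= Y x) ->
  (\int[P]_x (Y x ^+ 2)%:E <= v%:E)%E ->
  forall c, (\int[P]_x ((c + (Y x - fine (\int[P]_x (Y x)%:E)%E)) ^+ 2)%:E
    <= (c ^+ 2 + v)%:E)%E.
Proof.
move=> mY Y0 Yv c; set m := fine _.
have mY2 : measurable_fun setT (fun x => (Y x ^+ 2)%:E).
  by apply/measurable_EFinP; exact: measurable_funX.
have mYE : measurable_fun setT (fun x => (Y x)%:E) by exact/measurable_EFinP.
have iY2 : P.-integrable setT (fun x => (Y x ^+ 2)%:E).
  apply/integrableP; split => //.
  under eq_integral do rewrite gee0_abs ?lee_fin ?sqr_ge0//.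
  exact: le_lt_trans Yv (ltry _).
have i1 : P.-integrable setT (cst (1 : R)%:E).
  exact: finite_measure_integrable_cst.
(* Integrability follows from [Y <= 1 + Y ^+ 2]. *)
have iY : P.-integrable setT (fun x => (Y x)%:E).
  apply: (le_integrable measurableT mYE _ (integrableD measurableT i1 iY2)).
  move=> x _ /=; rewrite !lee_fin !ger0_norm//; last first.
    by rewrite addr_ge0// sqr_ge0.
  by have := sqr_ge0 (Y x - 1 / 2); lra.
have mE : (\int[P]_x (Y x)%:E = m%:E)%E.
  by rewrite fineK//; exact: integrable_fin_num.
rewrite [leLHS](_ : _ = \int[P]_x ((Y x ^+ 2)%:E +
   ((2 * (c - m))%:E * (Y x)%:E + ((c - m) ^+ 2)%:E)))%E; last first.
  by apply: eq_integral => x _; rewrite -EFinM -!EFinD; congr (_%:E); ring.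
have ic : P.-integrable setT (cst ((c - m) ^+ 2)%:E).
  exact: finite_measure_integrable_cst.
have icY : P.-integrable setT (fun x => ((2 * (c - m))%:E * (Y x)%:E)%E).
  exact: integrableZl.
rewrite integralD//; last exact: integrableD.
rewrite integralD// integralZl// mE integral_cst//=.
rewrite [P _]probability_setT mule1 -EFinM -EFinD.
apply: (le_trans (leeD2r _ Yv)); rewrite -EFinD lee_fin.
by have := sqr_ge0 m; lra.
Qed.

(** Chebyshev's inequality: [t ^+ 2] times the indicator of [A] lies below [U ^+ 2]. *)
Lemma probability_le_sqr (U : T -> R) (A : set T) (t v : R) :
  0 < t -> measurable A -> measurable_fun setT U ->
  (\int[P]_x (U x ^+ 2)%:E <= v%:E)%E ->
  (forall x, A x -> t <= `|U x|) -> (P A <= (v / t ^+ 2)%:E)%E.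
Proof.
move=> t0 mA mU Uv AU.
have t20 : 0 < t ^+ 2 by rewrite exprn_gt0.
rewrite EFinM lee_pdivlMr//; apply: le_trans Uv.
have <- : (\int[P]_x ((t ^+ 2)%:E * (\1_A x)%:E) = P A * (t ^+ 2)%:E)%E.
  rewrite ge0_integralZl//; last 2 first.
  - by apply/measurable_EFinP; exact: measurable_indic.
  - by rewrite lee_fin ltW.
  by rewrite integral_indic// setIT muleC.
apply: ge0_le_integral => //.
- by move=> x _; rewrite -EFinM lee_fin mulr_ge0// ltW.
- apply: emeasurable_funM => //.
  by apply/measurable_EFinP; exact: measurable_indic.
- by apply/measurable_EFinP; exact: measurable_funX.
- move=> x _; rewrite -EFinM lee_fin indicE; case: (boolP (x \in A)) => xA.
    rewrite mulr1 -[leRHS]real_normK ?num_real// lerXn2r ?nnegrE ?(ltW t0)//.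
    by apply: AU; exact: set_mem.
  by rewrite mulr0 sqr_ge0.
Qed.

End second_moment.

(** * Moments of truncated and shifted squares *)

Section normal_moments.
Context {R : realType}.
Local Notation T := (measurableTypeR R).
Variable s : R.
Hypothesis s0 : 0 < s.
Implicit Types (l : R).

(** The cut-off [4 * l] is matched to the moment of [expR (x ^+ 2 / (4 * s ^+ 2))]: it produces the
    factor [expR (- l / s ^+ 2)] that weights [nu2]. *)
Definition excess l (x : T) : R := Num.max (x ^+ 2 - 4 * l) 0.

Lemma excess_ge0 l x : 0 <= excess l x.
Proof. by rewrite le_max lexx orbT. Qed.

Lemma measurable_excess l : measurable_fun setT (excess l).
Proof.
by apply: measurable_maxr => //; apply: measurable_funB => //; exact: measurable_funX.
Qed.

Lemma integral_excess_sqr_le l :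
  (\int[normal_prob 0%R s]_x (excess l x ^+ 2)%:E
   <= (64 * s ^+ 4 * expR (- l / s ^+ 2))%:E)%E.
Proof.
have mexp : measurable_fun setT (fun x : T => (expR (x ^+ 2 / (4 * s ^+ 2)))%:E).
  apply/measurable_EFinP; apply: measurableT_comp => //.
  by apply: measurable_funM => //; exact: measurable_funX.
(* [32 = 2 * 4 ^+ 2] comes from [z ^+ 2 / 2 <= expR z] at [z = (x ^+ 2 - 4 * l) / (4 * s ^+ 2)]; the
   exponential moment doubles it to 64. *)
set K := 32 * s ^+ 4 * expR (- l / s ^+ 2).
have s40 : 0 <= s ^+ 4 by exact: exprn_ge0 (ltW s0).
have K0 : 0 <= K by rewrite /K mulr_ge0 ?expR_ge0// mulr_ge0.
apply: (@le_trans _ _ (\int[normal_prob 0%R s]_x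
    (K%:E * (expR (x ^+ 2 / (4 * s ^+ 2)))%:E))%E); last first.
  rewrite ge0_integralZl//.
  apply: (le_trans (lee_wpmul2l _ (integral_normal_expR_sqr s0))).
    by rewrite lee_fin.
  by rewrite -EFinM lee_fin /K; lra.
apply: ge0_le_integral => //.
- by move=> x _; rewrite lee_fin sqr_ge0.
- by apply/measurable_EFinP; apply: measurable_funX; exact: measurable_excess.
- exact: emeasurable_funM.
move=> x _; rewrite -EFinM lee_fin.
have -> : K * expR (x ^+ 2 / (4 * s ^+ 2)) =
    32 * s ^+ 4 * expR ((x ^+ 2 - 4 * l) / (4 * s ^+ 2)).
  by rewrite /K -mulrA -expRD; congr (_ * expR _); field; rewrite gt_eqF.
rewrite /excess; case: (leP (x ^+ 2 - 4 * l) 0) => y0.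
  by rewrite expr0n/= mulr_ge0 ?expR_ge0// mulr_ge0.
set y := x ^+ 2 - 4 * l in y0 *.
have z0 : 0 <= y / (4 * s ^+ 2).
  by rewrite divr_ge0 ?(ltW y0)// mulr_ge0// exprn_ge0// ltW.
have := expR_ge1Dxn 1 z0; rewrite [(1.+1)`!%:R](_ : _ = 2)//.
set e := expR _ => he.
have -> : y ^+ 2 = 32 * s ^+ 4 * ((y / (4 * s ^+ 2)) ^+ 2 / 2).
  by field; rewrite gt_eqF.
apply: ler_wpM2l; first by rewrite mulr_ge0.
by apply: le_trans he; rewrite lerDr.
Qed.

Lemma excess0E x : excess 0 x = x ^+ 2.
Proof. by rewrite /excess mulr0 subr0 max_l// sqr_ge0. Qed.

Definition mean_excess l : R :=
  fine (\int[normal_prob 0%R s]_x (excess l x)%:E)%E.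

(** A crude bound on the variance [s ^+ 2], from [t <= expR t] at [t = x ^+ 2 / (4 * s ^+ 2)] and
    the exponential moment. *)
Lemma integral_excess0_le :
  (\int[normal_prob 0%R s]_x (excess 0 x)%:E <= (8 * s ^+ 2)%:E)%E.
Proof.
have s20 : 0 < s ^+ 2 by rewrite exprn_gt0.
have mexp : measurable_fun setT (fun x : T => (expR (x ^+ 2 / (4 * s ^+ 2)))%:E).
  apply/measurable_EFinP; apply: measurableT_comp => //.
  by apply: measurable_funM => //; exact: measurable_funX.
apply: (@le_trans _ _ (\int[normal_prob 0%R s]_x
    ((4 * s ^+ 2)%:E * (expR (x ^+ 2 / (4 * s ^+ 2)))%:E))%E); last first.
  rewrite ge0_integralZl//; last by rewrite lee_fin mulr_ge0// ltW.
  apply: (le_trans (lee_wpmul2l _ (integral_normal_expR_sqr s0))).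
    by rewrite lee_fin mulr_ge0// ltW.
  by rewrite -EFinM lee_fin; lra.
apply: ge0_le_integral => //.
- by move=> x _; rewrite lee_fin excess_ge0.
- by apply/measurable_EFinP; exact: measurable_excess.
- exact: emeasurable_funM.
move=> x _; rewrite -EFinM lee_fin excess0E.
rewrite -ler_pdivrMl ?mulr_gt0// mulrC.
by apply: le_trans (expR_ge1Dx _); lra.
Qed.

Lemma integral_excess0E :
  (\int[normal_prob 0%R s]_x (excess 0 x)%:E = (mean_excess 0)%:E)%E.
Proof.
rewrite fineK// ge0_fin_numE; first exact: le_lt_trans integral_excess0_le (ltry _).
by apply: integral_ge0 => x _; rewrite lee_fin excess_ge0.
Qed.

Lemma mean_excess0_le : mean_excess 0 <= 8 * s ^+ 2.
Proof. by rewrite -lee_fin -integral_excess0E integral_excess0_le. Qed.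

(** Truncation only lowers the mean, so on the support of [theta] the centring may be replaced by
    that of the plain square. *)
Lemma le_mean_excess0 l : 0 <= l -> mean_excess l <= mean_excess 0.
Proof.
move=> l0.
have mex l' : measurable_fun setT (fun x => (excess l' x)%:E).
  by apply/measurable_EFinP; exact: measurable_excess.
have le_int : (\int[normal_prob 0%R s]_x (excess l x)%:E <=
               \int[normal_prob 0%R s]_x (excess 0 x)%:E)%E.
  apply: ge0_le_integral => //.
    by move=> x _; rewrite lee_fin excess_ge0.
  move=> x _; rewrite lee_fin excess0E /excess ge_max sqr_ge0 andbT.
  by rewrite gerBl mulr_ge0.
apply: fine_le => //.
  rewrite ge0_fin_numE; last first.
    by apply: integral_ge0 => x _; rewrite lee_fin excess_ge0.
  by rewrite (le_lt_trans le_int)// integral_excess0E ltry.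
by rewrite integral_excess0E.
Qed.

Lemma integral_sqr_excess_center_le l c :
  (\int[normal_prob 0%R s]_x ((c + (excess l x - mean_excess l)) ^+ 2)%:E
   <= (c ^+ 2 + 64 * s ^+ 4 * expR (- l / s ^+ 2))%:E)%E.
Proof.
apply: integral_sqr_center_le; first exact: measurable_excess.
  exact: excess_ge0.
exact: integral_excess_sqr_le.
Qed.

(** After the shift by [m] the centred variable is [(x ^+ 2 - mean_excess 0) + 2 * m * x]. The
    square contributes [64 * s ^+ 4], the linear part [4 * m ^+ 2] times the bound [8 * s ^+ 2]. *)
Lemma integral_sqr_shift_center_le m c :
  (\int[normal_prob m s]_x ((c + (x ^+ 2 - mean_excess 0 - m ^+ 2)) ^+ 2)%:E
   <= (c ^+ 2 + (64 * s ^+ 4 + 32 * s ^+ 2 * m ^+ 2))%:E)%E.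
Proof.
pose F (x : T) := ((c + ((x + m) ^+ 2 - mean_excess 0 - m ^+ 2)) ^+ 2)%:E.
have mF : measurable_fun setT F.
  apply/measurable_EFinP; apply: measurable_funX; apply: measurable_funD => //.
  by do 2 apply: measurable_funB => //; apply: measurable_funX; exact: measurable_funD.
have F0 x : (0 <= F x)%E by rewrite lee_fin sqr_ge0.
rewrite ge0_integral_normal_shift//; last 2 first.
- apply/measurable_EFinP; apply: measurable_funX; apply: measurable_funD => //.
  by do 2 apply: measurable_funB => //; exact: measurable_funX.
- by move=> x; rewrite lee_fin sqr_ge0.
have mFN : measurable_fun setT (fun x : T => F (- x)%R).
  by apply: (measurableT_comp mF); exact: oppr_measurable.
pose H (x : T) := ((c + (excess 0 x - mean_excess 0)) ^+ 2)%:E.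
pose Q (x : T) := ((4 * m ^+ 2)%:E * (excess 0 x)%:E)%E.
have mH : measurable_fun setT H.
  apply/measurable_EFinP; apply: measurable_funX; apply: measurable_funD => //.
  by apply: measurable_funB => //; exact: measurable_excess.
have mex : measurable_fun setT (fun x => (excess 0 x)%:E).
  by apply/measurable_EFinP; exact: measurable_excess.
have ex0 x : (0 <= (excess 0 x)%:E)%E by rewrite lee_fin excess_ge0.
have m40 : (0 <= (4 * m ^+ 2)%:E)%E by rewrite lee_fin mulr_ge0// sqr_ge0.
have mQ : measurable_fun setT Q by exact: emeasurable_funM.
have H0 x : (0 <= H x)%E by rewrite lee_fin sqr_ge0.
have Q0 x : (0 <= Q x)%E by rewrite mule_ge0.
have intHQ : (\int[normal_prob 0%R s]_x (H x + Q x) <=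
    (c ^+ 2 + (64 * s ^+ 4 + 32 * s ^+ 2 * m ^+ 2))%:E)%E.
  rewrite ge0_integralD//.
  apply: (le_trans (leeD2r _ (integral_sqr_excess_center_le 0 c))).
  rewrite oppr0 mul0r expR0 mulr1 ge0_integralZl// integral_excess0E -EFinM -EFinD.
  rewrite lee_fin -addrA lerD2l lerD2l.
  have -> : 32 * s ^+ 2 * m ^+ 2 = 4 * m ^+ 2 * (8 * s ^+ 2) by ring.
  by rewrite ler_wpM2l// mean_excess0_le.
apply: le_trans intHQ.
(* Averaging over the reflection [x |-> - x] removes the cross term, linear in [x]. *)
have two : (\int[normal_prob 0%R s]_x F x + \int[normal_prob 0%R s]_x F x =
    2%:E * \int[normal_prob 0%R s]_x (H x + Q x))%E.
  rewrite {2}(ge0_integral_normal_opp s0 mF F0) -ge0_integralD//.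
  rewrite -ge0_integralZl//; last 2 first.
  - exact: emeasurable_funD.
  - by move=> x _; rewrite adde_ge0.
  apply: eq_integral => x _; rewrite /F /H /Q excess0E -!(EFinM, EFinD).
  by congr (_%:E); ring.
have {}two : (2%:E * \int[normal_prob 0%R s]_x F x =
    2%:E * \int[normal_prob 0%R s]_x (H x + Q x))%E.
  rewrite -two (_ : 2%:E = 1%:E + 1%:E)%E; last by rewrite -EFinD.
  by rewrite ge0_muleDl ?lee_fin// mul1e.
by rewrite -(@lee_pmul2l _ 2%:E)// two.
Qed.

End normal_moments.

(** * Upper bound *)

(** The square of [1 / 2 <= expR (- (1 / 2))]. *)
Lemma expRN1_ge_quarter {R : realType} : 1 / 4 <= expR (- 1 : R).
Proof.
have h : 1 / 2 <= expR (- (1 / 2) : R).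
  by apply: le_trans (expR_ge1Dx _); lra.
have -> : -1 = - (1 / 2) + - (1 / 2) :> R by lra.
rewrite expRD; apply: (@le_trans _ _ (1 / 2 * (1 / 2))); first lra.
by apply: ler_pM => //; lra.
Qed.

Section upper_bound.
Context {R : realType} (d s : nat) (sigma : 'I_d -> R) (l nu eta : R).
Local Notation T := (measurableTypeR R).
Hypothesis sigma0 : forall j, 0 < sigma j.
Hypothesis l0 : 0 <= l.
Hypothesis nu0 : 0 < nu.
Hypothesis nuE : \sum_(j < d) sigma j ^+ 4 * expR (- l / sigma j ^+ 2) = nu ^+ 2.
Hypothesis eta01 : 0 < eta < 1.
Hypothesis s_gt0 : (0 < s)%N.

Let g := l * s%:R + nu.

Lemma sigma4_term_ge0 j : 0 <= sigma j ^+ 4 * expR (- l / sigma j ^+ 2).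
Proof. by rewrite mulr_ge0 ?expR_ge0// exprn_ge0// ltW. Qed.

(** Above the level [l] the exponential weight is at least [expR (- 1)]. *)
Lemma sigma4_le_weighted j : l <= sigma j ^+ 2 ->
  sigma j ^+ 4 <= 4 * (sigma j ^+ 4 * expR (- l / sigma j ^+ 2)).
Proof.
move=> lj; have s40 : 0 <= sigma j ^+ 4 by rewrite exprn_ge0// ltW.
have s20 : 0 < sigma j ^+ 2 by rewrite exprn_gt0.
have e1 : 1 / 4 <= expR (- l / sigma j ^+ 2).
  apply: (le_trans expRN1_ge_quarter); rewrite ler_expR mulNr lerN2.
  by rewrite ler_pdivrMr// mul1r.
have := ler_wpM2l s40 e1; lra.
Qed.

Lemma sigma2_le_nu j : l <= sigma j ^+ 2 -> sigma j ^+ 2 <= 2 * nu.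
Proof.
move=> lj; have s20 : 0 <= sigma j ^+ 2 by rewrite exprn_ge0// ltW.
rewrite -ler_sqr ?nnegrE//; last by rewrite mulr_ge0// ltW.
rewrite -exprM exprMn -nuE (_ : 2 ^+ 2 = 4); last by lra.
apply: (le_trans (sigma4_le_weighted lj)); rewrite ler_wpM2l//.
rewrite (bigD1 j)//= lerDl; apply: sumr_ge0 => i _; exact: sigma4_term_ge0.
Qed.

Lemma ler_mul_nat_gt0 k : (0 < k)%N -> l <= l * k%:R.
Proof. by move=> k0; rewrite ler_peMr// ler1n. Qed.

(** Above the level [l] a single term of [nuE] gives [2 * nu]; below it
    [sigma j ^+ 2 < l <= l * s]. *)
Lemma sigma2_le_rate j : sigma j ^+ 2 <= 2 * g.
Proof.
have := ler_mul_nat_gt0 s_gt0; rewrite /g.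
have [/sigma2_le_nu|] := leP l (sigma j ^+ 2); move: l0 nu0; lra.
Qed.

(** Terms below the level [l] cost at most [l ^+ 2] each, and there are at most [s] of them; the
    others are absorbed by [nu ^+ 2]. This controls the variance on the support of [theta], where
    the plain square replaces the truncated one. *)
Lemma sum_sigma4_le (S : pred 'I_d) : (#|S| <= s)%N ->
  \sum_(j < d | S j) sigma j ^+ 4 <= 4 * g ^+ 2.
Proof.
move=> cS.
apply: (@le_trans _ _ (\sum_(j < d | S j)
    (l ^+ 2 + 4 * (sigma j ^+ 4 * expR (- l / sigma j ^+ 2))))).
  apply: ler_sum => j _; have := sigma4_term_ge0 j.
  have [/sigma4_le_weighted|lj] := leP l (sigma j ^+ 2).
    by have := sqr_ge0 l; lra.
  have : sigma j ^+ 4 <= l ^+ 2; last by lra.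
  have s20 : 0 <= sigma j ^+ 2 by rewrite exprn_ge0// ltW.
  by rewrite (exprM _ 2 2) ler_sqr ?nnegrE// ltW.
rewrite big_split/= sumr_const -mulr_sumr.
have h1 : l ^+ 2 *+ #|S| <= (l * s%:R) ^+ 2.
  rewrite -mulr_natr exprMn; apply: ler_wpM2l; first exact: sqr_ge0.
  rewrite -natrX ler_nat (leq_trans cS)//.
  by case: s s_gt0 => // k _; rewrite leq_pmulr.
have h2 : \sum_(j < d | S j) sigma j ^+ 4 * expR (- l / sigma j ^+ 2) <= nu ^+ 2.
  rewrite -nuE [leRHS](bigID S)/= lerDl.
  by apply: sumr_ge0 => j _; exact: sigma4_term_ge0.
have h3 : 0 <= l * s%:R * nu by rewrite !mulr_ge0// ltW.
have h4 := sqr_ge0 (l * s%:R).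
by rewrite /g; move: h1 h2 h3 h4; set x := l * s%:R; nra.
Qed.

Let mean j := mean_excess (sigma j).

Let stat (x : d.-tuple T) : R :=
  \sum_(j < d) (excess l (tnth x j) - mean j l).

(** Against a null variance of [64 * nu ^+ 2], Chebyshev asks for [nu] times the square root of
    [2 * 64 / eta]; as that ratio exceeds 1, the ratio itself is enough. *)
Let threshold := (2 * 64) / eta * nu.

Let measurable_term j : measurable_fun setT (fun x : T => excess l x - mean j l).
Proof. by apply: measurable_funB => //; exact: measurable_excess. Qed.

Let measurable_stat : measurable_fun setT stat.
Proof. exact: (measurable_sum_tnth measurable_term). Qed.

Lemma threshold_type1_error :
  (gaussian [tuple 0%R | _ < d] sigma [set x | threshold < stat x]%R
   <= (eta / 2)%:E)%E.
Proof.
have [e0 e1] := andP eta01.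
have t0 : 0 < threshold by rewrite mulr_gt0// divr_gt0.
have mA : measurable [set x | threshold < stat x].
  rewrite -[X in measurable X]setTI; have : measurable_fun setT (fun x => threshold < stat x).
    exact: measurable_fun_ltr.
  by move=> /(_ measurableT [set true]); apply.
have var : (\int[gaussian [tuple 0%R | _ < d] sigma]_x (stat x ^+ 2)%:E <=
    (64 * nu ^+ 2)%:E)%E.
  have := @integral_gaussian_sqr_sum_le _ _ [tuple 0%R | _ < d] sigma
    (fun j x => excess l x - mean j l)
    (fun j => 64 * sigma j ^+ 4 * expR (- l / sigma j ^+ 2)) measurable_term _ 0.
  rewrite expr0n/= add0r.
  under eq_integral do rewrite add0r.
  under eq_bigr do rewrite -mulrA.
  rewrite -mulr_sumr nuE; apply.
  by move=> j c; rewrite tnth_mktuple; exact: integral_sqr_excess_center_le.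
apply: (le_trans (probability_le_sqr t0 mA measurable_stat var _)).
  by move=> x /= tx; apply: (le_trans (ltW tx)); exact: ler_norm.
rewrite lee_fin ler_pdivrMr ?exprn_gt0// /threshold exprMn.
have -> : eta / 2 * (((2 * 64) / eta) ^+ 2 * nu ^+ 2) = 64 * nu ^+ 2 * ((2 * 64) / eta).
  by field; rewrite gt_eqF.
apply: ler_peMr; first by rewrite mulr_ge0// sqr_ge0.
by rewrite ler_pdivlMr//; lra.
Qed.

Lemma threshold_type2_error (theta : d.-tuple R) :
  (norm0 theta <= s)%N -> (64 * 64) / eta * g <= \sum_(j < d) tnth theta j ^+ 2 ->
  (gaussian theta sigma [set x | (threshold < stat x)%R = false]
   <= (eta / 2)%:E)%E.
Proof.
move=> th0; set n := \sum_(j < d) _ => Cg.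
have [e0 e1] := andP eta01.
have g0 : 0 < g by rewrite ltr_wpDl// mulr_ge0.
have gn : g <= eta * n / (64 * 64).
  have := ler_wpM2l (ltW e0) Cg.
  have -> : eta * ((64 * 64) / eta * g) = (64 * 64) * g by field; rewrite gt_eqF.
  by rewrite ler_pdivlMr ?mulr_gt0// mulrC.
have n0 : 0 < n by apply: lt_le_trans Cg; rewrite mulr_gt0// divr_gt0.
(* [u j] is centred under [theta]: the term of the statistic off the support, the plain square on
   it. [v j] bounds its variance. *)
pose u j (x : T) : R := if tnth theta j != 0 then
  x ^+ 2 - mean j 0 - tnth theta j ^+ 2 else excess l x - mean j l.
pose v j : R := if tnth theta j != 0 then
  64 * sigma j ^+ 4 + 32 * sigma j ^+ 2 * tnth theta j ^+ 2
  else 64 * sigma j ^+ 4 * expR (- l / sigma j ^+ 2).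
have mu_ j : measurable_fun setT (u j).
  rewrite /u; case: (tnth theta j != 0) => //.
  by do 2 apply: measurable_funB => //; exact: measurable_funX.
have mU := measurable_sum_tnth mu_.
have mA : measurable [set x | (threshold < stat x) = false].
  rewrite -[X in measurable X]setTI; have : measurable_fun setT (fun x => threshold < stat x).
    exact: measurable_fun_ltr.
  by move=> /(_ measurableT [set false]); apply.
have var : (\int[gaussian theta sigma]_x
    ((\sum_(j < d) u j (tnth x j)) ^+ 2)%:E <= (\sum_(j < d) v j)%:E)%E.
  have := @integral_gaussian_sqr_sum_le _ _ theta sigma u v mu_ _ 0.
  rewrite expr0n/= add0r; under eq_integral do rewrite add0r.
  apply=> j c; rewrite /u /v; case: (boolP (tnth theta j != 0)) => [_|].
    exact: integral_sqr_shift_center_le.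
  by rewrite negbK => /eqP ->; exact: integral_sqr_excess_center_le.
(* [5 * 64] is [64 * 4] from [sum_sigma4_le] plus 64 from [nu <= g]; [64 * g] is [32] times the
   bound [2 * g] on [sigma j ^+ 2]. *)
have vle : \sum_(j < d) v j <= 5 * 64 * g ^+ 2 + 64 * g * n.
  apply: (@le_trans _ _ (\sum_(j < d) (64 * (if tnth theta j != 0 then sigma j ^+ 4 else 0)
     + 64 * g * tnth theta j ^+ 2 + 64 * (sigma j ^+ 4 * expR (- l / sigma j ^+ 2))))).
    apply: ler_sum => j _; rewrite /v; have := sigma4_term_ge0 j.
    case: ifPn => [_|].
      have := ler_wpM2r (sqr_ge0 (tnth theta j)) (sigma2_le_rate j); lra.
    by rewrite negbK => /eqP ->; lra.
  rewrite !big_split/= -!mulr_sumr nuE -big_mkcond/= -/n.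
  have := sum_sigma4_le th0; rewrite /=.
  have : nu ^+ 2 <= g ^+ 2.
    rewrite ler_sqr ?nnegrE ?(ltW nu0) ?(ltW g0)// /g lerDr mulr_ge0//.
  lra.
have n20 : 0 < n / 2 by rewrite divr_gt0.
apply: (le_trans (probability_le_sqr n20 mA mU var _)).
  move=> x /= /negbT; rewrite -leNgt => Tx.
  (* Truncation lowers a square by at most [4 * l], and this is paid only on the support, at most
     [s] times. *)
  have uT : \sum_(j < d) u j (tnth x j) <= stat x + 4 * (l * s%:R) - n.
    apply: (@le_trans _ _ (\sum_(j < d) ((excess l (tnth x j) - mean j l) +
       4 * (if tnth theta j != 0 then l else 0) - tnth theta j ^+ 2))).
      apply: ler_sum => j _; rewrite /u; case: ifPn => [_|]; last first.
        by rewrite negbK => /eqP ->; rewrite expr0n/=; lra.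
      have := le_mean_excess0 (sigma0 j) l0; rewrite -/(mean j l) -/(mean j 0).
      have : tnth x j ^+ 2 - 4 * l <= excess l (tnth x j) by rewrite le_max lexx.
      lra.
    rewrite big_split/= sumrN big_split/= -mulr_sumr -big_mkcond/= sumr_const.
    rewrite lerD2r lerD2l ler_wpM2l//.
    by rewrite -[l *+ _]mulr_natr; apply: ler_wpM2l; rewrite // ler_nat.
  rewrite ler_normr; apply/orP; right.
  rewrite lerNr (le_trans uT)//.
  (* Acceptance bounds the centred sum by [n / 32 + n / 1024 - n], which is below [- (n / 2)]. *)
  have : threshold <= (2 * 64) * n / (64 * 64).
    rewrite /threshold mulrAC ler_pdivrMr//.
    have : nu <= g by rewrite /g lerDr mulr_ge0.
    move: gn; lra.
  have : 4 * (l * s%:R) <= 4 * n / (64 * 64).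
    have : l * s%:R <= g by rewrite /g lerDl ltW.
    have : eta * n <= n by rewrite ler_piMl// ltW.
    move: gn; lra.
  move: Tx n0; lra.
rewrite lee_fin ler_pdivrMr ?exprn_gt0//; apply: (le_trans vle).
have gn2 : g * n <= eta * n / (64 * 64) * n by rewrite ler_wpM2r// ltW.
have : g ^+ 2 <= g * n.
  apply: (ler_wpM2l (ltW g0)); apply: (le_trans gn).
  have : eta * n <= n by rewrite ler_piMl// ltW.
  move: n0; lra.
(* In units of [eta * n / (64 * 64) * n] the target is 512, while the variance is at most
   [5 * 64 + 64 = 384], since both [g ^+ 2] and [g * n] are at most one unit. *)
rewrite (_ : eta / 2 * (n / 2) ^+ 2 = 8 * 64 * (eta * n / (64 * 64) * n)); last by field.
have : 0 <= eta * n / (64 * 64) * n by rewrite !mulr_ge0// ltW.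
move: gn2; lra.
Qed.

Lemma minimax_risk_le (eps : R) : 0 <= eps -> (64 * 64) / eta * g <= eps ^+ 2 ->
  (minimax_risk eps s sigma <= eta%:E)%E.
Proof.
move=> eps0 epsg.
have mpsi : measurable_fun setT (fun x => threshold < stat x).
  exact: measurable_fun_ltr.
pose psiM := isMeasurableFun.Build _ _ _ _ (fun x => threshold < stat x) mpsi.
pose psi : test R d := HB.pack (fun x => threshold < stat x) psiM.
apply: (@le_trans _ _ (risk psi eps s sigma)).
  by apply: ereal_inf_lbound; exists psi.
rewrite (splitr eta) EFinD /risk; apply: leeD; first exact: threshold_type1_error.
apply: ge_ereal_sup => _ [theta [epsth th0] <-].
apply: threshold_type2_error => //; apply: (le_trans epsg).
have sum0 : 0 <= \sum_(j < d) tnth theta j ^+ 2.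
  by apply: sumr_ge0 => j _; exact: sqr_ge0.
rewrite -[leRHS](sqr_sqrtr sum0) ler_sqr ?nnegrE//.
Qed.

End upper_bound.

(** * Bayesian lower bound *)

Section mixture.
Context {R : realType} (d s : nat) (sigma : 'I_d -> R) (eps : R).
Local Notation T := (measurableTypeR R).
Hypothesis sigma0 : forall j, 0 < sigma j.
Variables (I : finType) (w : I -> R) (theta : I -> d.-tuple R).
Hypothesis w0 : forall i, 0 <= w i.
Hypothesis w1 : \sum_i w i = 1.
Hypothesis w_alt : forall i, w i != 0 -> alternative eps s (theta i).

Local Notation G := (gaussian [tuple 0%R | _ < d] sigma).

Let L (x : d.-tuple T) : R := \sum_i w i * gaussian_likelihood (theta i) sigma x.

Let measurable_wlik i :
  measurable_fun setT (fun x => w i * gaussian_likelihood (theta i) sigma x).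
Proof. by apply: measurable_funM => //; exact: measurable_gaussian_likelihood. Qed.

Let measurable_L : measurable_fun setT L.
Proof. by apply: measurable_sum => i; exact: measurable_wlik. Qed.

Let wlik_ge0 i x : 0 <= w i * gaussian_likelihood (theta i) sigma x.
Proof. by rewrite mulr_ge0// gaussian_likelihood_ge0. Qed.

Let L_ge0 x : 0 <= L x. Proof. by apply: sumr_ge0. Qed.

Let integral_L (B : set (d.-tuple T)) : measurable B ->
  (\int[G]_(x in B) (L x)%:E = \sum_i (w i)%:E * gaussian (theta i) sigma B)%E.
Proof.
move=> mB; rewrite /L.
under eq_integral do rewrite -sumEFin.
rewrite ge0_integral_sum//; last 2 first.
- move=> i; apply/measurable_EFinP; apply: measurable_funTS; exact: measurable_wlik.
- by move=> i x _; rewrite lee_fin.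
apply: eq_bigr => i _; rewrite gaussian_prob_likelihood//.
under eq_integral do rewrite EFinM.
rewrite ge0_integralZl//.
- by apply/measurable_EFinP; apply: measurable_funTS; exact: measurable_gaussian_likelihood.
- by move=> x _; rewrite lee_fin gaussian_likelihood_ge0.
- by rewrite lee_fin.
Qed.

(** The average is at most the supremum because indices outside the alternative have weight zero. *)
Let integral_L_le (B : set (d.-tuple T)) : measurable B ->
  (\int[G]_(x in B) (L x)%:E <=
   ereal_sup [set gaussian th sigma B | th in alternative eps s])%E.
Proof.
move=> mB; rewrite integral_L//; set S := ereal_sup _.
apply: (@le_trans _ _ (\sum_i (w i)%:E * S)%E).
  apply: lee_sum => i _; have [->|wi] := eqVneq (w i) 0; first by rewrite !mul0e.
  apply: lee_wpmul2l; first by rewrite lee_fin.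
  by apply: ereal_sup_ubound; exists (theta i) => //; exact: w_alt.
rewrite -ge0_sume_distrl; last by move=> i _; rewrite lee_fin.
by rewrite sumEFin w1 mul1e.
Qed.

Let integral_L_sqr : (\int[G]_x (L x ^+ 2)%:E = (\sum_i \sum_i' w i * w i' *
  \prod_(j < d) expR (tnth (theta i) j * tnth (theta i') j / sigma j ^+ 2))%:E)%E.
Proof.
have mll i i' : measurable_fun setT (fun x => (gaussian_likelihood (theta i) sigma x *
    gaussian_likelihood (theta i') sigma x)%:E).
  by apply/measurable_EFinP; apply: measurable_funM; exact: measurable_gaussian_likelihood.
have ll0 i i' x : (0 <= (gaussian_likelihood (theta i) sigma x *
    gaussian_likelihood (theta i') sigma x)%:E)%E.
  by rewrite lee_fin mulr_ge0// gaussian_likelihood_ge0.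
have ww0 i i' : (0 <= (w i * w i')%:E)%E by rewrite lee_fin mulr_ge0.
transitivity (\int[G]_x \sum_i \sum_i' ((w i * w i')%:E *
  (gaussian_likelihood (theta i) sigma x * gaussian_likelihood (theta i') sigma x)%:E))%E.
  apply: eq_integral => x _; rewrite expr2 /L big_distrlr/= -sumEFin.
  apply: eq_bigr => i _; rewrite -sumEFin; apply: eq_bigr => i' _.
  by rewrite -EFinM mulrACA.
rewrite ge0_integral_sum//; last 2 first.
- by move=> i; apply: emeasurable_sum => i'; exact: emeasurable_funM.
- by move=> i x _; apply: sume_ge0 => i' _; exact: mule_ge0.
rewrite -sumEFin; apply: eq_bigr => i _.
rewrite ge0_integral_sum//; last 2 first.
- by move=> i'; exact: emeasurable_funM.
- by move=> i' x _; exact: mule_ge0.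
rewrite -sumEFin; apply: eq_bigr => i' _.
by rewrite ge0_integralZl// integral_gaussian_likelihoodM.
Qed.

(** Pointwise [1 <= L x + k / 2 + (1 - L x) ^+ 2 / (2 * k)], the difference being a square.
    Integrated over the acceptance region [B], this bounds the null probability of [B] by the worst
    type II error plus [k / 2 + chi / (2 * k)]. *)
Lemma mixture_risk_ge (psi : test R d) (k chi : R) : 0 < k ->
  \sum_i \sum_i' w i * w i' *
    \prod_(j < d) expR (tnth (theta i) j * tnth (theta i') j / sigma j ^+ 2)
    <= 1 + chi ->
  ((1 - k / 2 - chi / (2 * k))%:E <= risk psi eps s sigma)%E.
Proof.
move=> k0 hchi.
have mA : measurable [set x | psi x = true].
  by rewrite -[X in measurable X]setTI; exact: (measurable_funPT psi measurableT [set true]).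
have mB : measurable [set x | psi x = false].
  by rewrite -[X in measurable X]setTI; exact: (measurable_funPT psi measurableT [set false]).
set A := [set x | psi x = true] in mA *; set B := [set x | psi x = false] in mB *.
have AB : A = ~` B.
  by apply/seteqP; split => x; rewrite /A /B /=; case: (psi x).
have mL2 : measurable_fun setT (fun x => ((1 - L x) ^+ 2)%:E).
  by apply/measurable_EFinP; apply: measurable_funX; apply: measurable_funB.
have mLE : measurable_fun setT (fun x => (L x)%:E) by exact/measurable_EFinP.
have L0E x : (0 <= (L x)%:E)%E by rewrite lee_fin.
have sq0 x : (0 <= ((1 - L x) ^+ 2)%:E)%E by rewrite lee_fin sqr_ge0.
have Q : (\int[G]_x ((1 - L x) ^+ 2)%:E <= chi%:E)%E.
  (* Adding [2], the integral of [2 * L x], turns the integrand into [1 + L x ^+ 2] and keeps every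
     integrand nonnegative. *)
  have : (\int[G]_x ((1 - L x) ^+ 2)%:E + 2%:E <= (2 + chi)%:E)%E.
    have -> : (2%:E = \int[G]_x (2%:E * (L x)%:E))%E.
      rewrite ge0_integralZl// integral_L//.
      under eq_bigr do rewrite [X in (_ * X)%E]probability_setT mule1.
      by rewrite sumEFin w1 mule1.
    rewrite -ge0_integralD//; last 2 first.
      by move=> x _; rewrite mule_ge0.
      exact: emeasurable_funM.
    rewrite [leLHS](_ : _ = \int[G]_x (1%:E + (L x ^+ 2)%:E))%E; last first.
      by apply: eq_integral => x _; rewrite -EFinM -!EFinD; congr (_%:E); ring.
    rewrite ge0_integralD//; last 2 first.
      by move=> x _; rewrite lee_fin sqr_ge0.
      by apply/measurable_EFinP; exact: measurable_funX.
    rewrite integral_cst// [X in (_ * X)%E]probability_setT mule1 integral_L_sqr.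
    by rewrite -EFinD lee_fin; move: hchi; lra.
  have : (0 <= \int[G]_x ((1 - L x) ^+ 2)%:E)%E by exact: integral_ge0.
  case: (\int[G]_x ((1 - L x) ^+ 2)%:E)%E => [q| |]//=.
  by rewrite -EFinD !lee_fin; lra.
set S := ereal_sup [set gaussian th sigma B | th in alternative eps s].
have GB : (G B <= S + (k / 2 + chi / (2 * k))%:E)%E.
  pose H x : R := k / 2 + (1 - L x) ^+ 2 * (2 * k)^-1.
  have mH : measurable_fun setT (fun x => (H x)%:E).
    apply/measurable_EFinP; apply: measurable_funD => //; apply: measurable_funM => //.
    by apply: measurable_funX; apply: measurable_funB.
  have H0 x : (0 <= (H x)%:E)%E.
    by rewrite lee_fin addr_ge0 ?divr_ge0 ?sqr_ge0 ?mulr_ge0// ltW.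
  apply: (@le_trans _ _ (\int[G]_(x in B) ((L x)%:E + (H x)%:E))%E).
    rewrite -[leLHS]mul1e -(integral_cst G mB 1).
    apply: ge0_le_integral => //.
      by apply: emeasurable_funD; exact: measurable_funTS.
    move=> x _; rewrite -EFinD lee_fin /H.
    rewrite -subr_ge0 (_ : _ - _ = (1 - L x - k) ^+ 2 * (2 * k)^-1); last first.
      by field; rewrite gt_eqF.
    by rewrite mulr_ge0 ?sqr_ge0// invr_ge0 mulr_ge0// ltW.
  rewrite ge0_integralD//; [|exact: measurable_funTS|exact: measurable_funTS].
  apply: leeD; first exact: integral_L_le.
  apply: (@le_trans _ _ (\int[G]_x (H x)%:E)%E); first exact: ge0_subset_integral.
  rewrite [leLHS](_ : _ = \int[G]_x
    ((k / 2)%:E + ((1 - L x) ^+ 2)%:E * ((2 * k)^-1)%:E))%E; last first.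
    by apply: eq_integral => x _; rewrite -EFinM -EFinD.
  have k20 : (0 <= ((2 * k)^-1)%:E)%E by rewrite lee_fin invr_ge0 mulr_ge0// ltW.
  rewrite ge0_integralD//; last 3 first.
    by move=> x _; rewrite lee_fin divr_ge0// ltW.
    by move=> x _; rewrite mule_ge0.
    exact: emeasurable_funM.
  rewrite integral_cst// [X in (_ * X)%E]probability_setT mule1.
  rewrite EFinD leeD2l// ge0_integralZr//.
  by rewrite EFinM lee_wpmul2r.
rewrite /risk -/A -/B -/S AB probability_setC//.
have GBf : G B \is a fin_num by exact: fin_num_measure.
rewrite -(fineK GBf) in GB *.
move: GB; case: S => [r| |]//.
  by rewrite -!EFinD !lee_fin; lra.
by move=> _; rewrite leey.
Qed.

End mixture.

(** * Sparse random supports *)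

Section bernoulli_product.
Context {R : realType} (d : nat) (p : 'I_d -> R).
Hypothesis p01 : forall j, 0 <= p j <= 1.
Implicit Types b : {ffun 'I_d -> bool}.

Definition bernoulli_product b : R :=
  \prod_(j < d) (if b j then p j else 1 - p j).

Lemma bernoulli_product_ge0 b : 0 <= bernoulli_product b.
Proof.
apply: prodr_ge0 => j _; have /andP[p0 p1] := p01 j.
by case: (b j); rewrite ?subr_ge0.
Qed.

Lemma sum_bernoulli_product (F : 'I_d -> bool -> R) :
  \sum_b bernoulli_product b * \prod_(j < d) F j (b j) =
  \prod_(j < d) (p j * F j true + (1 - p j) * F j false).
Proof.
transitivity (\prod_(j < d) \sum_(e : bool) (if e then p j else 1 - p j) * F j e).
  rewrite bigA_distr_bigA; apply: eq_bigr => b _.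
  by rewrite /bernoulli_product -big_split.
by apply: eq_bigr => j _; rewrite big_bool.
Qed.

(** Total mass, means and cross moments are the cases of an empty set, a singleton and a pair. *)
Lemma sum_bernoulli_product_set (K : {set 'I_d}) :
  \sum_b bernoulli_product b * \prod_(j in K) (b j)%:R = \prod_(j in K) p j.
Proof.
pose F (j : 'I_d) (e : bool) : R := if j \in K then e%:R else 1.
transitivity (\sum_b bernoulli_product b * \prod_(j < d) F j (b j)).
  by apply: eq_bigr => b _; rewrite [in LHS]big_mkcond.
rewrite sum_bernoulli_product /F [RHS]big_mkcond; apply: eq_bigr => j _.
by case: (j \in K); rewrite ?mulr1 ?mulr0; ring.
Qed.

Lemma sum_bernoulli_product1 : \sum_b bernoulli_product b = 1.
Proof.
have := sum_bernoulli_product_set finset.set0; rewrite big_set0.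
by under eq_bigr => b _ do rewrite big_set0 mulr1.
Qed.

Lemma bernoulli_product_mean i :
  \sum_b bernoulli_product b * (b i)%:R = p i.
Proof.
have := sum_bernoulli_product_set [set i]%SET; rewrite big_set1.
by under eq_bigr do rewrite big_set1.
Qed.

Lemma bernoulli_product_cross i j : i != j ->
  \sum_b bernoulli_product b * ((b i)%:R * (b j)%:R) = p i * p j.
Proof.
move=> ij; have ij' : i \notin [set j]%SET by rewrite inE.
have := sum_bernoulli_product_set (i |: [set j])%SET.
rewrite big_setU1//= big_set1.
by under eq_bigr do rewrite big_setU1//= big_set1.
Qed.

(** The expectation factors over coordinates, and factor [j] differs from 1 only if both independent
    copies select [j], with probability [p j ^+ 2]. *)
Lemma bernoulli_product_exp (u : 'I_d -> R) :
  \sum_b \sum_b' bernoulli_product b * bernoulli_product b' *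
     \prod_(j < d) expR (u j * ((b j)%:R * (b' j)%:R)) =
  \prod_(j < d) (1 + p j ^+ 2 * (expR (u j) - 1)).
Proof.
transitivity (\sum_b bernoulli_product b *
    \prod_(j < d) (p j * expR (u j * (b j)%:R) + (1 - p j))).
  apply: eq_bigr => b _; under eq_bigr do rewrite -mulrA.
  rewrite -mulr_sumr; congr (_ * _).
  rewrite (sum_bernoulli_product (fun j e => expR (u j * ((b j)%:R * e%:R)))).
  by apply: eq_bigr => j _; rewrite !mulr1 !mulr0 expR0 mulr1.
rewrite (sum_bernoulli_product (fun j e => p j * expR (u j * e%:R) + (1 - p j))).
by apply: eq_bigr => j _; rewrite mulr1 mulr0 expR0; ring.
Qed.

(** * Probability of a sparse support of large weight *)

Section truncation.
Variables (s : nat) (r : 'I_d -> R) (M : R).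
Hypothesis s0 : (0 < s)%N.
Hypothesis r0 : forall j, 0 <= r j.
Hypothesis M0 : 0 < M.
Hypothesis p_sum : \sum_(j < d) p j <= s%:R / 2.
Hypothesis prM : \sum_(j < d) p j * r j = M.
Hypothesis rM : forall j, r j <= 4 * M.

Let W b : R := \sum_(j < d) r j * (b j)%:R.
Let N b : nat := #|[pred j | b j]|.

Definition typical : pred {ffun 'I_d -> bool} :=
  [pred b : {ffun 'I_d -> bool} | (#|[pred j | b j]| <= s)%N &
    M / 4 <= \sum_(j < d) r j * (b j)%:R].

Let NE b : (N b)%:R = \sum_(j < d) (b j)%:R :> R.
Proof.
rewrite /N -sum1_card natr_sum big_mkcond/=.
by apply: eq_bigr => j _; rewrite inE; case: (b j).
Qed.

Let W_ge0 b : 0 <= W b.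
Proof. by apply: sumr_ge0 => j _; rewrite mulr_ge0. Qed.

Let W_mean : \sum_b bernoulli_product b * W b = M.
Proof.
under eq_bigr do rewrite /W mulr_sumr.
rewrite exchange_big/= -prM; apply: eq_bigr => j _.
under eq_bigr do rewrite mulrCA.
by rewrite -mulr_sumr bernoulli_product_mean mulrC.
Qed.

(** The part without the extra diagonal contributes [M ^+ 2]. On the diagonal [b i] is its own
    square, and [r i <= 4 * M] gives [4 * M ^+ 2] more. *)
Let W_sqr : \sum_b bernoulli_product b * W b ^+ 2 <= 5 * M ^+ 2.
Proof.
have cross i j : \sum_b bernoulli_product b * ((b i)%:R * (b j)%:R) <=
    p i * p j + (if j == i then p i else 0).
  case: (eqVneq j i) => [->|ji]; last first.
    by rewrite addr0 bernoulli_product_cross// eq_sym.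
  rewrite [leLHS](_ : _ = p i); first by rewrite lerDr -expr2 sqr_ge0.
  rewrite -[RHS](bernoulli_product_mean i); apply: eq_bigr => b _.
  by case: (b i); rewrite ?mulr1 ?mulr0.
apply: (@le_trans _ _ (\sum_i \sum_j r i * r j *
    (p i * p j + (if j == i then p i else 0)))).
  apply: (@le_trans _ _ (\sum_i \sum_j r i * r j *
      \sum_b bernoulli_product b * ((b i)%:R * (b j)%:R))).
    rewrite le_eqVlt; apply/orP; left; apply/eqP.
    under eq_bigr do rewrite /W expr2 big_distrlr mulr_sumr/=.
    rewrite exchange_big/=; apply: eq_bigr => i _.
    under eq_bigr do rewrite mulr_sumr.
    rewrite exchange_big/=; apply: eq_bigr => j _.
    by rewrite mulr_sumr; apply: eq_bigr => b _; ring.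
  by apply: ler_sum => i _; apply: ler_sum => j _; rewrite ler_wpM2l// mulr_ge0.
apply: (@le_trans _ _ (\sum_i (p i * r i * M + 4 * M * (p i * r i)))); last first.
  by rewrite big_split/= -mulr_suml -mulr_sumr prM; lra.
apply: ler_sum => i _; under eq_bigr do rewrite mulrDr.
have /andP[pi0 _] := p01 i.
rewrite big_split/=; apply: lerD.
  rewrite -prM mulr_sumr le_eqVlt; apply/orP; left; apply/eqP.
  by apply: eq_bigr => j _; ring.
rewrite (bigD1 i)//= eqxx big1 ?addr0; last first.
  by move=> j /negbTE ->; rewrite mulr0.
have := ler_wpM2r (mulr_ge0 pi0 (r0 i)) (rM i).
by rewrite (_ : r i * r i * p i = r i * (p i * r i)); [|ring].
Qed.

(** If [j] is selected and more than [s] indices are, then at least [s] others are, so the indicator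
    is at most [(\sum_(i | i != j) (b i)%:R) / s%:R]. This is independent of [b j] and has mean at
    most 1/2. *)
Let W_overflow : \sum_b bernoulli_product b * (W b * (s < N b)%N%:R) <= M / 2.
Proof.
have sR : 0 < s%:R :> R by rewrite ltr0n.
apply: (@le_trans _ _ (\sum_b bernoulli_product b *
   \sum_j r j * ((b j)%:R * (\sum_(i | i != j) (b i)%:R) / s%:R))).
  apply: ler_sum => b _; rewrite ler_wpM2l ?bernoulli_product_ge0//.
  rewrite /W mulr_suml; apply: ler_sum => j _.
  rewrite -mulrA ler_wpM2l//.
  case bj: (b j); rewrite ?mul0r ?mul1r//.
  have -> : \sum_(i < d | i != j) (b i)%:R = (N b)%:R - 1 :> R.
    by rewrite NE [in RHS](bigD1 j)//= bj addrAC subrr add0r.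
  case: (ltnP s (N b)) => sN; last first.
    rewrite divr_ge0 ?(ltW sR)// subr_ge0 ler1n.
    by apply/card_gt0P; exists j; rewrite inE.
  by rewrite ler_pdivlMr// mul1r lerBrDr natr1 ler_nat.
under eq_bigr do rewrite mulr_sumr.
rewrite exchange_big/=.
apply: (@le_trans _ _ (\sum_(j < d) p j * r j / 2)); last first.
  by rewrite -mulr_suml prM.
apply: ler_sum => j _; have /andP[pj0 _] := p01 j.
have -> : \sum_b bernoulli_product b *
    (r j * ((b j)%:R * (\sum_(i < d | i != j) (b i)%:R) / s%:R)) =
    r j / s%:R * \sum_(i < d | i != j) p j * p i.
  rewrite mulr_sumr.
  under eq_bigr do rewrite mulr_sumr mulr_suml !mulr_sumr.
  rewrite exchange_big/=; apply: eq_bigr => i ij.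
  rewrite -bernoulli_product_cross 1?eq_sym// mulr_sumr.
  by apply: eq_bigr => b _; ring.
have h : \sum_(i < d | i != j) p i <= s%:R / 2.
  apply: le_trans p_sum; rewrite [leRHS](bigD1 j)//=.
  by rewrite lerDr.
rewrite -mulr_sumr.
have sV0 : 0 <= s%:R^-1 :> R by rewrite invr_ge0 ltW.
have := ler_wpM2l (mulr_ge0 (mulr_ge0 pj0 (r0 j)) sV0) h.
have -> : p j * r j / s%:R * (s%:R / 2) = p j * r j / 2 by field; rewrite gt_eqF.
by apply: le_trans; rewrite le_eqVlt; apply/orP; left; apply/eqP; ring.
Qed.

(** Taking expectations in [pt] gives [M <= M / 2 + M / 4 + M / 8 + 10 * M * P], where [P] is the
    probability of [typical]. *)
Lemma typical_ge : 1 / 80 <= \sum_(b | typical b) bernoulli_product b.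
Proof.
have pt b : W b <= W b * (s < N b)%N%:R + M / 4 + W b ^+ 2 / (40 * M) +
    10 * M * (typical b)%:R.
  have q0 : 0 <= W b ^+ 2 / (40 * M) by rewrite divr_ge0 ?sqr_ge0// mulr_ge0// ltW.
  have W0 := W_ge0 b.
  rewrite /typical /= -/(W b) -/(N b).
  case: (ltnP s (N b)) => sN /=; first by rewrite mulr1 mulr0; move: M0; lra.
  have [WM|WM] := leP (M / 4) (W b); rewrite ?mulr1 ?mulr0; last by move: M0; lra.
  (* The arithmetic-geometric mean inequality, with weights making [W_sqr] cost only [M / 8]. *)
  suff : W b <= W b ^+ 2 / (40 * M) + 10 * M by move: M0; lra.
  rewrite -subr_ge0 (_ : _ - _ = (W b - 20 * M) ^+ 2 / (40 * M)); last first.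
    by field; rewrite gt_eqF.
  by rewrite divr_ge0 ?sqr_ge0// mulr_ge0// ltW.
have : \sum_b bernoulli_product b * W b <= \sum_b bernoulli_product b *
    (W b * (s < N b)%N%:R + M / 4 + W b ^+ 2 / (40 * M) + 10 * M * (typical b)%:R).
  by apply: ler_sum => b _; rewrite ler_wpM2l ?bernoulli_product_ge0.
rewrite W_mean.
under [X in _ <= X -> _]eq_bigr do rewrite !mulrDr.
rewrite !big_split/= -mulr_suml sum_bernoulli_product1.
have -> : \sum_b bernoulli_product b * (W b ^+ 2 / (40 * M)) =
    (\sum_b bernoulli_product b * W b ^+ 2) / (40 * M).
  by rewrite mulr_suml; apply: eq_bigr => b _; rewrite mulrA.
have -> : \sum_b bernoulli_product b * (10 * M * (typical b)%:R) =
    10 * M * \sum_(b | typical b) bernoulli_product b.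
  rewrite mulr_sumr [RHS]big_mkcond; apply: eq_bigr => b _.
  by case: (typical b); rewrite ?mulr1 ?mulr0// mulrC.
set P := \sum_(b | typical b) _ => h.
have h2 : (\sum_b bernoulli_product b * W b ^+ 2) / (40 * M) <= M / 8.
  rewrite ler_pdivrMr ?mulr_gt0//; apply: (le_trans W_sqr).
  by rewrite le_eqVlt; apply/orP; left; apply/eqP; field.
have h3 : M / 8 <= M * (10 * P).
  by move: h h2 W_overflow; lra.
have : 1 / 8 <= 10 * P by rewrite -(ler_pM2l M0) mulrA mulr1.
lra.
Qed.

End truncation.
End bernoulli_product.

(** The tangent at [c * v] lies below the exponential at [0] and at [v]; the two bounds are combined
    with weights [1 - c] and [c]. *)
Lemma expR_convex0 {R : realType} (c v : R) : 0 <= c <= 1 ->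
  expR (c * v) - 1 <= c * (expR v - 1).
Proof.
move=> /andP[c0 c1]; set y := c * v.
have hv : expR y * (1 + (v - y)) <= expR v.
  rewrite -[in leRHS](subrK y v) expRD [leRHS]mulrC.
  by rewrite ler_wpM2l ?expR_ge0// expR_ge1Dx.
have h0 : expR y * (1 - y) <= 1.
  by rewrite -[leRHS](expRxMexpNx_1 y) ler_wpM2l ?expR_ge0// expR_ge1Dx.
have := ler_wpM2l c0 hv.
have c1' : 0 <= 1 - c by rewrite subr_ge0.
have := ler_wpM2l c1' h0.
have : (1 - c) * (expR y * (1 - y)) + c * (expR y * (1 + (v - y))) = expR y.
  by rewrite /y; ring.
lra.
Qed.

(** * The sparse prior and the lower bound on the risk *)

Section lower_bound.
Context {R : realType} (d s : nat) (sigma : 'I_d -> R) (l nu eta : R).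
Hypothesis sigma0 : forall j, 0 < sigma j.
Hypothesis l0 : 0 <= l.
Hypothesis nu0 : 0 < nu.
Hypothesis nuE : \sum_(j < d) sigma j ^+ 4 * expR (- l / sigma j ^+ 2) = nu ^+ 2.
Hypothesis eta01 : 0 < eta < 1.
Hypothesis s_gt0 : (0 < s)%N.
Hypothesis sum_le : \sum_(j < d) sigma j ^+ 2 * expR (- l / sigma j ^+ 2)
  <= s%:R / 2 * nu.
Hypothesis sum_eq : l * (\sum_(j < d) sigma j ^+ 2 * expR (- l / sigma j ^+ 2))
  = l * (s%:R / 2 * nu).

Let p j := sigma j ^+ 2 * expR (- l / sigma j ^+ 2) / nu.
Let r j := l + sigma j ^+ 2.
Let M := l * (s%:R / 2) + nu.
Let kap := (1 - eta) ^+ 2 / (64 * 64 * 16).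

Let s20 j : 0 < sigma j ^+ 2. Proof. by rewrite exprn_gt0. Qed.

(** The exponential weight is at most 1, so its square is no larger than itself, and
    [(p j * nu) ^+ 2] is at most one term of [nuE]. *)
Let p01 j : 0 <= p j <= 1.
Proof.
have e0 : 0 <= sigma j ^+ 2 * expR (- l / sigma j ^+ 2).
  by rewrite mulr_ge0 ?expR_ge0// ltW.
rewrite /p divr_ge0 ?(ltW nu0)//= ler_pdivrMr// mul1r.
rewrite -ler_sqr ?nnegrE ?(ltW nu0)// -nuE (bigD1 j)//= -[leLHS]addr0.
apply: lerD; last by apply: sumr_ge0 => i _; exact: sigma4_term_ge0.
rewrite exprMn -exprM; apply: ler_wpM2l; first by rewrite exprn_ge0// ltW.
rewrite expr2 ler_piMl ?expR_ge0// -expR0 ler_expR mulNr oppr_le0.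
by rewrite divr_ge0// ltW.
Qed.

Let p_sum : \sum_(j < d) p j <= s%:R / 2.
Proof. by rewrite /p -mulr_suml ler_pdivrMr. Qed.

(** The part of [r] equal to [l] uses [sum_eq], the equation for [beta] multiplied by [l] so that it
    survives [l = 0]; the part [sigma j ^+ 2] sums to [nu ^+ 2 / nu]. *)
Let prM : \sum_(j < d) p j * r j = M.
Proof.
under eq_bigr do rewrite /r mulrDr.
rewrite big_split/= -mulr_suml /M; congr (_ + _).
  by rewrite /p -mulr_suml mulrC mulrA sum_eq; field; rewrite gt_eqF.
transitivity (nu ^+ 2 / nu); last by field; rewrite gt_eqF.
rewrite -nuE mulr_suml; apply: eq_bigr => j _; rewrite /p.
by field; rewrite gt_eqF.
Qed.

Let l_le : l <= 2 * (l * (s%:R / 2)).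
Proof. by have := ler_mul_nat_gt0 l0 s_gt0; lra. Qed.

Let rM j : r j <= 4 * M.
Proof.
rewrite /r /M; have := l_le; have := l0; have := nu0.
by have [/(sigma2_le_nu sigma0 nu0 nuE)|] := leP l (sigma j ^+ 2); lra.
Qed.

Let r0 j : 0 <= r j. Proof. by rewrite addr_ge0// ltW. Qed.

Let M0 : 0 < M. Proof. by rewrite ltr_wpDl// mulr_ge0// divr_ge0. Qed.

Local Notation Pr := (bernoulli_product p).
Local Notation typ := (typical s r M).

Let kap0 : 0 < kap.
Proof.
have [_ e1] := andP eta01.
by rewrite divr_gt0 ?exprn_gt0 ?subr_gt0// !mulr_gt0.
Qed.

Let kap_le : kap <= 1 / 64.
Proof.
have [e0 e1] := andP eta01.
have : (1 - eta) ^+ 2 <= 1 by rewrite expr_le1 ?subr_ge0 ?(ltW e1)// gerBl ltW.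
by rewrite /kap; lra.
Qed.

Let typ_ge : 1 / 80 <= \sum_(b | typ b) Pr b.
Proof. exact: typical_ge. Qed.

Let theta (b : {ffun 'I_d -> bool}) : d.-tuple R :=
  [tuple if b j then Num.sqrt (kap * r j) else 0 | j < d].

Let theta_alt eps b : 0 <= eps -> eps ^+ 2 <= kap * (M / 4) -> typ b ->
  alternative eps s (theta b).
Proof.
move=> eps0 epsM /andP[/= Nb Wb]; split; last first.
  apply: leq_trans Nb; apply: subset_leq_card; apply/fintype.subsetP => j.
  by rewrite !inE tnth_mktuple; case: (b j) => //; rewrite eqxx.
rewrite /norm2 -(ger0_norm eps0) -sqrtr_sqr.
have -> : \sum_(j < d) tnth (theta b) j ^+ 2 = kap * \sum_(j < d) r j * (b j)%:R.
  rewrite mulr_sumr; apply: eq_bigr => j _; rewrite tnth_mktuple.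
  case: (b j); last by rewrite expr0n/= !mulr0.
  by rewrite sqr_sqrtr ?mulr1// mulr_ge0// ltW.
apply: ler_wsqrtr; apply: (le_trans epsM).
by rewrite ler_wpM2l// ltW.
Qed.

Let u j := kap * (1 + l / sigma j ^+ 2).

Let u0 j : 0 <= u j.
Proof. by rewrite mulr_ge0 ?(ltW kap0)// addr_ge0// divr_ge0// ltW. Qed.

Let X (b b' : {ffun 'I_d -> bool}) : R :=
  \prod_(j < d) expR (u j * ((b j)%:R * (b' j)%:R)).

Let X_ge1 b b' : 1 <= X b b'.
Proof.
rewrite /X -expR_sum -expR0 ler_expR; apply: sumr_ge0 => j _.
by rewrite mulr_ge0// mulr_ge0.
Qed.

Let theta_X b b' : \prod_(j < d) expR (tnth (theta b) j * tnth (theta b') j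
  / sigma j ^+ 2) = X b b'.
Proof.
apply: eq_bigr => j _; congr expR; rewrite !tnth_mktuple.
case: (b j); case: (b' j); rewrite ?(mulr0, mul0r)// !mulr1.
rewrite -expr2 sqr_sqrtr; last by rewrite mulr_ge0// ltW.
by rewrite /u /r; field; rewrite gt_eqF.
Qed.

(** Convexity pulls [kap] out of the exponent, and [expR (l / sigma j ^+ 2)] cancels one of the two
    decaying factors in [p j ^+ 2]. What remains sums to [kap * expR 1 <= 4 * kap]. *)
Let prior_chi2 : \sum_b \sum_b' Pr b * Pr b' * X b b' - 1 <= 8 * kap.
Proof.
rewrite (bernoulli_product_exp p u).
have kap01 : 0 <= kap <= 1 by rewrite ltW//=; move: kap_le; lra.
have step : \prod_(j < d) (1 + p j ^+ 2 * (expR (u j) - 1)) <= expR (4 * kap).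
  apply: (@le_trans _ _ (\prod_(j < d) expR (p j ^+ 2 * (expR (u j) - 1)))).
    apply: ler_prod => j _; rewrite expR_ge1Dx andbT.
    by rewrite addr_ge0// mulr_ge0 ?sqr_ge0// subr_ge0 -expR0 ler_expR.
  rewrite -expR_sum ler_expR.
  apply: (@le_trans _ _ (\sum_(j < d) kap * expR 1 / nu ^+ 2 *
      (sigma j ^+ 4 * expR (- l / sigma j ^+ 2)))).
    apply: ler_sum => j _.
    apply: (@le_trans _ _ (p j ^+ 2 * (kap * expR (1 + l / sigma j ^+ 2)))).
      apply: ler_wpM2l; first exact: sqr_ge0.
      apply: (le_trans (expR_convex0 (1 + l / sigma j ^+ 2) kap01)).
      by rewrite ler_wpM2l ?(ltW kap0)// gerBl.
    rewrite le_eqVlt; apply/orP; left; apply/eqP; rewrite /p expRD.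
    have -> : expR (l / sigma j ^+ 2) = (expR (- l / sigma j ^+ 2))^-1.
      by rewrite -expRN mulNr opprK.
    by field; rewrite !gt_eqF// expR_gt0.
  rewrite -mulr_sumr nuE.
  have -> : kap * expR 1 / nu ^+ 2 * nu ^+ 2 = expR 1 * kap.
    by field; rewrite gt_eqF.
  apply: ler_wpM2r; first exact: ltW.
  by have := @expRN1_ge_quarter R; rewrite expRN div1r lef_pV2 ?posrE ?expR_gt0.
(* [expR (4 * kap) <= 1 + 8 * kap] is obtained by multiplying with [1 - 4 * kap], positive since
   [kap <= 1 / 64]. *)
have e1 : (1 - 4 * kap) * expR (4 * kap) <= 1.
  rewrite -[leRHS](expRxMexpNx_1 (4 * kap)) mulrC ler_wpM2l ?expR_ge0//.
  exact: expR_ge1Dx.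
have : (1 - 4 * kap) * expR (4 * kap) <= (1 - 4 * kap) * (1 + 8 * kap).
  apply: (le_trans e1); have := ler_wpM2l (ltW kap0) kap_le; lra.
rewrite ler_pM2l; last by move: kap_le; lra.
by move: step; lra.
Qed.

Lemma minimax_risk_gt (eps : R) : 0 <= eps ->
  eps ^+ 2 <= (1 - eta) ^+ 2 / (64 * 64 * 16 * 8) * (l * s%:R + nu) ->
  (eta%:E < minimax_risk eps s sigma)%E.
Proof.
move=> eps0 epsg; have [e0 e1] := andP eta01.
have := typ_ge; set P := \sum_(b | typ b) Pr b => P_ge.
have P0 : 0 < P by apply: lt_le_trans P_ge; rewrite divr_gt0.
have Pr0 := bernoulli_product_ge0 p01.
(* The Bernoulli prior conditioned on typical supports. *)
pose w b := if typ b then Pr b / P else 0.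
have w0 b : 0 <= w b by rewrite /w; case: ifP => // _; rewrite divr_ge0// ltW.
have w1 : \sum_b w b = 1.
  by rewrite -big_mkcond/= -mulr_suml divff// gt_eqF.
have w_le b : w b <= 80 * Pr b.
  rewrite /w; case: ifP => _; last by rewrite mulr_ge0.
  rewrite ler_pdivrMr// mulrAC ler_peMl//.
  by move: P_ge; lra.
have epsM : eps ^+ 2 <= kap * (M / 4).
  apply: (le_trans epsg); rewrite /M.
  (* The factor 8 is lost because [M / 4] contains [l * s / 8]. *)
  have -> : (1 - eta) ^+ 2 / (64 * 64 * 16 * 8) = kap / 8 by rewrite /kap; field.
  have := ltW (mulr_gt0 kap0 nu0); lra.
have w_alt b : w b != 0 -> alternative eps s (theta b).
  by rewrite /w; case: ifP => [tb _|_]; [exact: theta_alt|rewrite eqxx].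
have chi2 : \sum_b \sum_b' w b * w b' * \prod_(j < d)
    expR (tnth (theta b) j * tnth (theta b') j / sigma j ^+ 2)
    <= 1 + 80 * 80 * (8 * kap).
  under eq_bigr do under eq_bigr do rewrite theta_X.
  (* Only the excess [X b b' - 1] is compared: it is nonnegative, so [w <= 80 * Pr] applies to both
     weights. *)
  apply: (@le_trans _ _ (\sum_b \sum_b' (w b * w b' +
      80 * 80 * (Pr b * Pr b' * X b b' - Pr b * Pr b')))).
    apply: ler_sum => b _; apply: ler_sum => b' _.
    have X1 : 0 <= X b b' - 1 by rewrite subr_ge0.
    have := ler_wpM2r X1 (ler_pM (w0 b) (w0 b') (w_le b) (w_le b')).
    lra.
  under eq_bigr do rewrite big_split/= -mulr_sumr -mulr_sumr big_split/= sumrN.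
  rewrite big_split/= -mulr_suml w1 -mulr_sumr big_split/= sumrN.
  have -> : \sum_b \sum_b' Pr b * Pr b' = 1.
    under eq_bigr do rewrite -mulr_sumr sum_bernoulli_product1 mulr1.
    exact: sum_bernoulli_product1.
  by have := prior_chi2; lra.
have q0 : 0 < 1 - eta by rewrite subr_gt0.
(* With [k = 1 - eta] the risk is at least [1 - 57 / 64 * (1 - eta)], which exceeds [eta]. *)
apply: (@lt_le_trans _ _
    (1 - (1 - eta) / 2 - 80 * 80 * (8 * kap) / (2 * (1 - eta)))%:E).
  rewrite lte_fin.
  have -> : 80 * 80 * (8 * kap) / (2 * (1 - eta)) = 25 / 64 * (1 - eta).
    by rewrite /kap; field; rewrite gt_eqF.
  lra.
apply: le_ereal_inf_tmp => _ [psi _ <-].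
exact: mixture_risk_ge chi2.
Qed.

End lower_bound.

(** * The tuning parameters *)

Section tuning.
Context {R : realType} (d s : nat) (sigma : 'I_d -> R).
Hypothesis sigma0 : forall j, 0 < sigma j.
Hypothesis s_gt0 : (0 < s)%N.
Hypothesis d_gt0 : (0 < d)%N.

Let A (b : R) := \sum_(j < d) sigma j ^+ 2 * expR (- b / sigma j ^+ 2).
Let B (b : R) := \sum_(j < d) sigma j ^+ 4 * expR (- b / sigma j ^+ 2).

Let s20 j : 0 < sigma j ^+ 2. Proof. by rewrite exprn_gt0. Qed.
Let s40 j : 0 < sigma j ^+ 4. Proof. by rewrite exprn_gt0. Qed.

Let A_term b j : 0 < sigma j ^+ 2 * expR (- b / sigma j ^+ 2).
Proof. by rewrite mulr_gt0 ?expR_gt0. Qed.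

Let B_term b j : 0 < sigma j ^+ 4 * expR (- b / sigma j ^+ 2).
Proof. by rewrite mulr_gt0 ?expR_gt0. Qed.

Let B_gt0 b : 0 < B b.
Proof.
rewrite /B (bigD1 (Ordinal d_gt0))//= ltr_pwDl// sumr_ge0// => j _.
exact: ltW.
Qed.

Let A_ge0 b : 0 <= A b.
Proof. by apply: sumr_ge0 => j _; exact: ltW. Qed.

Let le_term (F : 'I_d -> R) j : (forall i, 0 <= F i) -> F j <= \sum_i F i.
Proof. by move=> F0; rewrite (bigD1 j)//= lerDl sumr_ge0. Qed.

Let ratio b := A b / Num.sqrt (B b).

Let continuous_weighted k : continuous
  (fun b : R => \sum_(j < d) sigma j ^+ k * expR (- b / sigma j ^+ 2)).
Proof.
apply: continuous_big => [|j _ b]; first by move=> z; apply: cvgD; [exact: cvg_fst|exact: cvg_snd].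
apply: cvgM; first exact: cvg_cst.
apply: continuous_comp; last exact: continuous_expR.
apply: cvgM; last exact: cvg_cst.
exact: oppr_continuous.
Qed.

Let continuous_ratio : continuous ratio.
Proof.
move=> b; apply: cvgM; first exact: continuous_weighted.
apply: cvgV; first by rewrite gt_eqF// sqrtr_gt0.
apply: continuous_comp; first exact: continuous_weighted.
exact: sqrt_continuous.
Qed.

(** At this point every exponential is at least [s ^+ 2], so [sigma j ^+ 2 * s ^+ 2 <= A] for all
    [j]; summing against the terms of [A] gives [B * s ^+ 2 <= A ^+ 2]. *)
Let ratio_large : s%:R / 2 <= ratio (- (s%:R ^+ 2 * \sum_j sigma j ^+ 2)).
Proof.
set t := s%:R ^+ 2 * _; rewrite /ratio ler_pdivlMr ?sqrtr_gt0//.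
have sA j : sigma j ^+ 2 * s%:R ^+ 2 <= A (- t).
  apply: le_trans (le_term j (fun i => ltW (A_term (- t) i))).
  rewrite ler_wpM2l ?(ltW (s20 j))// opprK; apply: le_trans (expR_ge1Dx _).
  rewrite -[leLHS]add0r lerD// ler_pdivlMr// ler_wpM2l ?sqr_ge0//.
  by apply: le_term => i; exact: ltW.
have BA : B (- t) * s%:R ^+ 2 <= A (- t) ^+ 2.
  apply: (@le_trans _ _ (\sum_(j < d)
      A (- t) * (sigma j ^+ 2 * expR (- (- t) / sigma j ^+ 2)))).
    rewrite /B mulr_suml; apply: ler_sum => j _.
    rewrite (_ : sigma j ^+ 4 * _ * _ = sigma j ^+ 2 * s%:R ^+ 2 *
      (sigma j ^+ 2 * expR (- (- t) / sigma j ^+ 2))); last by ring.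
    by apply: ler_wpM2r; [exact: ltW|exact: sA].
  by rewrite -mulr_sumr.
have : (Num.sqrt (B (- t)) * s%:R) <= A (- t).
  by rewrite -ler_sqr ?nnegrE ?mulr_ge0 ?sqrtr_ge0// exprMn sqr_sqrtr// ltW.
have : 0 <= s%:R * Num.sqrt (B (- t)) by rewrite mulr_ge0 ?sqrtr_ge0.
lra.
Qed.

(** Halving the exponent splits each term of [A] into a factor at most the square root of [B] and
    one at most [1 / (2 * d)]. *)
Let ratio_small : ratio (4 * d%:R * \sum_j sigma j ^+ 2) <= s%:R / 2.
Proof.
set t := 4 * d%:R * _; rewrite /ratio ler_pdivrMr ?sqrtr_gt0//.
have dR : 0 < d%:R :> R by rewrite ltr0n.
have half j : expR (- t / sigma j ^+ 2) = expR (- t / (2 * sigma j ^+ 2)) ^+ 2.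
  by rewrite [RHS]expr2 -expRD; congr expR; field; rewrite gt_eqF.
have le_sqrtB j : sigma j ^+ 2 * expR (- t / (2 * sigma j ^+ 2)) <= Num.sqrt (B t).
  have e0 : 0 <= sigma j ^+ 2 * expR (- t / (2 * sigma j ^+ 2)).
    by apply: mulr_ge0; [exact: ltW|exact: expR_ge0].
  rewrite -(ger0_norm e0) -sqrtr_sqr.
  apply: ler_wsqrtr; rewrite exprMn -half -exprM.
  exact: (le_term j (fun i => ltW (B_term t i))).
have small j : expR (- t / (2 * sigma j ^+ 2)) <= (2 * d%:R)^-1.
  rewrite mulNr expRN lef_pV2 ?posrE ?expR_gt0 ?mulr_gt0//.
  apply: le_trans (expR_ge1Dx _).
  rewrite -[leLHS]add0r lerD// ler_pdivlMr ?mulr_gt0//.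
  have : sigma j ^+ 2 <= \sum_i sigma i ^+ 2.
    exact: (le_term j (fun i => ltW (s20 i))).
  move=> /(ler_wpM2l (ltW dR)); rewrite /t; lra.
apply: (@le_trans _ _ (\sum_(j < d) Num.sqrt (B t) * (2 * d%:R)^-1)).
  apply: ler_sum => j _; rewrite half [expR _ ^+ 2]expr2 mulrA.
  apply: ler_pM => //.
  by apply: mulr_ge0; [exact: ltW|exact: expR_ge0].
rewrite sumr_const card_ord -[leLHS]mulr_natr.
have -> : Num.sqrt (B t) / (2 * d%:R) * d%:R = 1 / 2 * Num.sqrt (B t).
  by field; rewrite gt_eqF.
by rewrite ler_wpM2r ?sqrtr_ge0// ler_wpM2r// ler1n.
Qed.

(** The intermediate value theorem provides a solution, and [get] then returns one. *)
Lemma beta_equation_beta : beta_equation s sigma (beta s sigma).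
Proof.
apply: getPex.
set t1 := - (s%:R ^+ 2 * \sum_j sigma j ^+ 2).
set t2 := 4 * d%:R * \sum_j sigma j ^+ 2.
have S0 : 0 <= \sum_j sigma j ^+ 2 by apply: sumr_ge0 => j _; exact: ltW.
have t12 : t1 <= t2.
  apply: (@le_trans _ _ 0); first by rewrite oppr_le0 mulr_ge0 ?sqr_ge0.
  by rewrite !mulr_ge0.
have cr : {within `[t1, t2], continuous ratio}.
  exact: continuous_subspaceT.
have [|c _ ratioc] := @IVT _ ratio t1 t2 (s%:R / 2) t12 cr; last by exists c.
by rewrite ge_min le_max ratio_small ratio_large orbT.
Qed.

(* Chebyshev's sum inequality: [sigma j ^+ 2] and the weights
   [expR (- b / sigma j ^+ 2)] are oppositely ordered when [b <= 0]. *)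
Let chebyshev_sum b : b <= 0 -> B b * A 0 <= A b * B 0.
Proof.
move=> b0.
pose a j := sigma j ^+ 2; pose w j := expR (- b / sigma j ^+ 2).
have AE : A b = \sum_j a j * w j by [].
have A0E : A 0 = \sum_j a j.
  by apply: eq_bigr => j _; rewrite oppr0 mul0r expR0 mulr1.
have BE : B b = \sum_j a j ^+ 2 * w j.
  by apply: eq_bigr => j _; rewrite /a -exprM.
have B0E : B 0 = \sum_j a j ^+ 2.
  by apply: eq_bigr => j _; rewrite oppr0 mul0r expR0 mulr1 /a -exprM.
rewrite AE A0E BE B0E -subr_ge0 !big_distrlr/=.
set D := _ - _.
have D1 : D = \sum_i \sum_j a i * a j * w i * (a j - a i).
  rewrite /D -sumrB; apply: eq_bigr => i _.
  by rewrite -sumrB; apply: eq_bigr => j _; ring.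
have D2 : D = \sum_i \sum_j a i * a j * w j * (a i - a j).
  by rewrite D1 exchange_big/=; apply: eq_bigr => i _; apply: eq_bigr => j _; ring.
suff : 0 <= D + D by rewrite -mulr2n pmulrn_lge0.
rewrite {1}D1 D2 -big_split/=; apply: sumr_ge0 => i _.
rewrite -big_split/=; apply: sumr_ge0 => j _.
rewrite [leRHS](_ : _ = a i * a j * ((w i - w j) * (a j - a i))); last by ring.
have w_anti i' j' : a i' <= a j' -> w j' <= w i'.
  move=> aij; rewrite /w ler_expR ler_wpM2l ?oppr_ge0//.
  by rewrite lef_pV2 ?posrE ?s20.
apply: mulr_ge0; first by apply: mulr_ge0; exact: ltW (s20 _).
have [aij|/ltW aij] := leP (a i) (a j).
  by rewrite mulr_ge0 ?subr_ge0// w_anti.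
by rewrite mulr_le0 ?subr_le0// w_anti.
Qed.

Lemma lambda2_ge0 : 0 <= lambda2 s sigma.
Proof. by rewrite le_max lexx orbT. Qed.

Lemma nu2_gt0 : 0 < nu2 s sigma.
Proof. by rewrite sqrtr_gt0; exact: B_gt0. Qed.

Lemma nu2_sqr :
  \sum_(j < d) sigma j ^+ 4 * expR (- lambda2 s sigma / sigma j ^+ 2) =
  nu2 s sigma ^+ 2.
Proof. by rewrite sqr_sqrtr// ltW//; exact: B_gt0. Qed.

Let A_beta : A (beta s sigma) = s%:R / 2 * Num.sqrt (B (beta s sigma)).
Proof.
have := beta_equation_beta; rewrite /beta_equation -/(A _) -/(B _) => <-.
by rewrite divfK// gt_eqF// sqrtr_gt0.
Qed.

Lemma lambda2_sum_eq : lambda2 s sigma *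
    (\sum_(j < d) sigma j ^+ 2 * expR (- lambda2 s sigma / sigma j ^+ 2)) =
  lambda2 s sigma * (s%:R / 2 * nu2 s sigma).
Proof.
rewrite /nu2 -/(A _) -/(B _) /lambda2.
by case: (leP (beta s sigma) 0) => [_|_]; [rewrite !mul0r|rewrite A_beta].
Qed.

(** For [beta > 0] this is the equation itself. For [beta <= 0] the claim concerns [0], and the
    ratio does not increase from [beta] to [0], by [chebyshev_sum] and [A 0 <= A beta]. *)
Lemma lambda2_sum_le :
  \sum_(j < d) sigma j ^+ 2 * expR (- lambda2 s sigma / sigma j ^+ 2) <=
  s%:R / 2 * nu2 s sigma.
Proof.
rewrite /nu2 -/(A _) -/(B _) /lambda2.
case: (leP (beta s sigma) 0) => [b0|_]; last by rewrite A_beta.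
set b := beta s sigma in b0 *.
have A0b : A 0 <= A b.
  apply: ler_sum => j _; rewrite oppr0 mul0r expR0 mulr1.
  rewrite ler_peMr ?(ltW (s20 j))// -expR0 ler_expR.
  by rewrite mulr_ge0 ?oppr_ge0// invr_ge0 ltW.
have AB : A 0 ^+ 2 * B b <= A b ^+ 2 * B 0.
  have := ler_wpM2l (A_ge0 0) (chebyshev_sum b0).
  have := ler_wpM2r (mulr_ge0 (A_ge0 b) (ltW (B_gt0 0))) A0b.
  lra.
have sR : 0 <= s%:R / 2 :> R by rewrite divr_ge0.
rewrite -ler_sqr ?nnegrE ?A_ge0 ?mulr_ge0 ?sqrtr_ge0//.
rewrite exprMn sqr_sqrtr ?(ltW (B_gt0 0))//.
rewrite -(ler_pM2r (B_gt0 b)); apply: (le_trans AB).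
rewrite [A b]A_beta exprMn sqr_sqrtr ?(ltW (B_gt0 b))//.
by rewrite mulrAC.
Qed.

Hypothesis sigma_anti : forall i j : 'I_d, (i <= j)%N -> sigma j <= sigma i.

(** Since [sigma] is nonincreasing, the indices reaching the level [lambda2] form an initial
    segment; [j.+1] is the rank of [j]. *)
Lemma leq_jstarE (j : 'I_d) :
  (j.+1 <= jstar s sigma)%N = (lambda2 s sigma <= sigma j ^+ 2).
Proof.
apply/idP/idP => [|lj]; last exact: (leq_bigmax_cond (F := fun j : 'I_d => j.+1)).
apply: contraTT; rewrite -ltNge -leqNgt => jl.
apply/bigmax_leqP => i il; rewrite ltnNge; apply/negP => ji.
move: jl; rewrite ltNge => /negP; apply; apply: (le_trans il).
by rewrite ler_sqr ?nnegrE ?(ltW (sigma0 _))//; exact: sigma_anti.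
Qed.

Let head_normE : head_norm s sigma ^+ 2 =
  \sum_(j < d | lambda2 s sigma <= sigma j ^+ 2) sigma j ^+ 4.
Proof.
rewrite sqr_sqrtr; last by apply: sumr_ge0 => j _; exact: ltW.
by apply: eq_bigl => j; rewrite leq_jstarE.
Qed.

Lemma head_norm_le : head_norm s sigma <= 2 * nu2 s sigma.
Proof.
rewrite -ler_sqr ?nnegrE ?sqrtr_ge0 ?mulr_ge0 ?(ltW nu2_gt0)//.
rewrite head_normE exprMn -nu2_sqr.
apply: (@le_trans _ _ (\sum_(j < d | lambda2 s sigma <= sigma j ^+ 2)
    4 * (sigma j ^+ 4 * expR (- lambda2 s sigma / sigma j ^+ 2)))).
  by apply: ler_sum => j lj; exact: sigma4_le_weighted.
rewrite -mulr_sumr (_ : 2 ^+ 2 = 4); last by lra.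
rewrite ler_wpM2l// [leRHS](bigID (fun j => lambda2 s sigma <= sigma j ^+ 2))/=.
by rewrite lerDl; apply: sumr_ge0 => j _; exact: ltW.
Qed.

(** Below the level, [sigma j ^+ 4 <= l * sigma j ^+ 2], and [lambda2_sum_eq] sums the tail to
    [l * (s / 2 * nu)]. Were [nu > l * s + h], then [nu ^+ 2] would exceed [l * s * nu + h ^+ 2],
    contradicting [nu_split]. *)
Lemma nu2_le : nu2 s sigma <= lambda2 s sigma * s%:R + head_norm s sigma.
Proof.
set l := lambda2 s sigma; set nu := nu2 s sigma; set h := head_norm s sigma.
have nu0 : 0 < nu := nu2_gt0; have l0 : 0 <= l := lambda2_ge0.
have h0 : 0 <= h by rewrite sqrtr_ge0.
have nu_split : nu ^+ 2 <= h ^+ 2 + l * (s%:R / 2 * nu).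
  rewrite -nu2_sqr head_normE -lambda2_sum_eq.
  rewrite (bigID (fun j => l <= sigma j ^+ 2))/=; apply: lerD.
    apply: ler_sum => j _; rewrite ler_piMr ?(ltW (s40 j))//.
    by rewrite -expR0 ler_expR mulNr oppr_le0 divr_ge0// ltW.
  rewrite mulr_sumr [leRHS](bigID (fun j => l <= sigma j ^+ 2))/=.
  rewrite -[leLHS]add0r; apply: lerD.
    by apply: sumr_ge0 => j _; rewrite mulr_ge0// ltW.
  apply: ler_sum => j; rewrite -ltNge => lj.
  rewrite (exprM _ 2 2) expr2 -mulrA; apply: ler_wpM2r; first exact: ltW.
  exact: ltW.
have ls0 : 0 <= l * s%:R by rewrite mulr_ge0.
rewrite leNgt; apply/negP => lt_nu.
have hnu : h * h <= h * nu by apply: ler_wpM2l => //; move: ls0 lt_nu; lra.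
have := mulr_ge0 ls0 (ltW nu0).
have : nu * (l * s%:R + h) < nu * nu by rewrite ltr_pM2l.
move: nu_split; rewrite !expr2; lra.
Qed.

End tuning.

(** * Two-sided bounds on the separation radius *)

Theorem corollary2 (R : realType) (eta : R) (heta : 0 < eta < 1) :
  exists c C : R, [/\ 0 < c, 0 < C &
    forall (d s : nat) (sigma : 'I_d -> R),
      (1 <= d)%N ->
      (forall i j : 'I_d, (i <= j)%N -> sigma j <= sigma i) ->
      (forall j : 'I_d, 0 < sigma j) ->
      (1 <= s <= d)%N ->
      let f := (separation_radius eta s sigma ^+ 2)%E in
      let g := lambda2 s sigma * s%:R + nu2 s sigma in
      let h := lambda2 s sigma * s%:R + head_norm s sigma in
      [/\ ((c * g)%:E <= f)%E, (f <= (C * g)%:E)%E, c * h <= g & g <= C * h]].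
Proof.
have [eta0 eta1] := andP heta.
set c := (1 - eta) ^+ 2 / (64 * 64 * 16 * 8).
have c0 : 0 < c by rewrite divr_gt0 ?exprn_gt0 ?subr_gt0// !mulr_gt0.
have C0 : 0 < 64 * 64 / eta by rewrite divr_gt0// mulr_gt0.
exists c, (64 * 64 / eta); split => // d s sigma d0 santi s0 /andP[s1 sd] f g h.
have l0 := lambda2_ge0 s sigma.
have nu0 := nu2_gt0 s s0 d0.
have nuE := nu2_sqr s s0 d0.
have ls0 : 0 <= lambda2 s sigma * s%:R by rewrite mulr_ge0.
have g0 : 0 < g by rewrite ltr_wpDl.
have hn0 : 0 <= head_norm s sigma by rewrite sqrtr_ge0.
have sep_ub : (separation_radius eta s sigma <=
    (Num.sqrt (64 * 64 / eta * g))%:E)%E.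
  apply: ereal_inf_lbound; exists (Num.sqrt (64 * 64 / eta * g)) => //.
  split; first by rewrite sqrtr_gt0 mulr_gt0.
  apply: (minimax_risk_le s0 l0 nu0 nuE heta s1); first exact: sqrtr_ge0.
  by rewrite sqr_sqrtr// ltW// mulr_gt0.
have sep_lb : ((Num.sqrt (c * g))%:E <= separation_radius eta s sigma)%E.
  apply: le_ereal_inf_tmp => _ [eps [eps0 risk_le] <-].
  rewrite lee_fin leNgt; apply/negP => eps_lt.
  have : (eta%:E < minimax_risk eps s sigma)%E.
    apply: (minimax_risk_gt s0 l0 nu0 nuE heta s1 (lambda2_sum_le s0 s1 d0)
      (lambda2_sum_eq s0 s1 d0) (ltW eps0)).
    rewrite -[leRHS]sqr_sqrtr ?(ltW (mulr_gt0 c0 g0))//.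
    by rewrite ler_sqr ?nnegrE ?sqrtr_ge0 ?(ltW eps0) ?(ltW eps_lt).
  by rewrite ltNge risk_le.
(* Lying between two reals, the radius is finite, so both bounds can be squared. *)
have [r rE] : exists r : R, separation_radius eta s sigma = r%:E.
  move: sep_ub sep_lb; case: (separation_radius eta s sigma) => [r|//|//] _ _.
  by exists r.
rewrite rE lee_fin in sep_ub; rewrite rE lee_fin in sep_lb.
have r0 : 0 <= r by apply: le_trans sep_lb; exact: sqrtr_ge0.
(* The same constants serve the second equivalence, which needs only [2] and [1 / 2]. *)
have C2 : 2 <= 64 * 64 / eta by rewrite ler_pdivlMr//; lra.
have c2 : c <= 1 / 2.
  have : (1 - eta) ^+ 2 <= 1 by rewrite expr_le1 ?subr_ge0 ?(ltW eta1)// gerBl ltW.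
  by rewrite /c; lra.
have h0 : 0 <= h by rewrite addr_ge0.
split.
- rewrite /f rE -EFin_expe lee_fin -[leLHS]sqr_sqrtr ?(ltW (mulr_gt0 c0 g0))//.
  by rewrite ler_sqr ?nnegrE ?sqrtr_ge0.
- rewrite /f rE -EFin_expe lee_fin -[leRHS]sqr_sqrtr ?(ltW (mulr_gt0 C0 g0))//.
  by rewrite ler_sqr ?nnegrE ?sqrtr_ge0.
- apply: (@le_trans _ _ (1 / 2 * h)); first by rewrite ler_wpM2r.
  have := head_norm_le s s0 d0 santi; rewrite /h /g; lra.
- apply: (@le_trans _ _ (2 * h)); last by rewrite ler_wpM2r.
  have := nu2_le s0 s1 d0 santi; rewrite /h /g; lra.
Qed.
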